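(* Let $\mathbb{G}$ be a Carnot group of step $k\ge 2$ with horizontal layer of dimension $m$, and let $(\Omega_0,\overline{\Omega}_1)$ be a condenser in $\mathbb{G}$, i.e. $\Omega_0,\Omega_1\subset\mathbb{G}$ are connected bounded open sets with $\overline{\Omega}_1\subset\Omega_0$; put $\Omega=\Omega_0\setminus\overline{\Omega}_1$. Assume that $\Omega_0$ and $\Omega_1$ are both starshaped with respect to a point $p_0\in\Omega_1$. Let $\mathscr{F}:\overline{\Omega}_0\times\mathbb{R}\times\mathbb{R}^m\times\mathscr{S}_m(\mathbb{R})\to\mathbb{R}$ satisfy the following hypotheses. (i) (Proper) For all $p\in\Omega$, $\xi\in\mathbb{R}^m$, $M\in\mathscr{S}_m(\mathbb{R})$: $\mathscr{F}(p,r,\xi,M)\le\mathscr{F}(p,s,\xi,M)$ whenever $r\ge s$. (ii) (Degenerate elliptic) For all $p\in\Omega$, $r\in\mathbb{R}$, $\xi\in\mathbb{R}^m$: $\mathscr{F}(p,r,\xi,M)\le\mathscr{F}(p,r,\xi,N)$ whenever $M,N\in\mathscr{S}_m(\mathbb{R})$ and $M\le N$. (iii) (Stable under the scalings centered at $p_0$) For all $(p,r,\xi,M)$ and all $\lambda\ge 1$ such that $p\in\Omega$ and $(\delta^{p_0}_\lambda)^{-1}(p)\in\Omega$: $$\mathscr{F}(p,r,\xi,M)\ge 0\ \Longrightarrow\ \mathscr{F}\big((\delta^{p_0}_\lambda)^{-1}(p),\,r,\,\lambda\xi,\,\lambda^2M\big)\ge 0 .$$ (iv) (Comparison principle) If $u,v\in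 C(\overline{\Omega})$ are respectively a viscosity subsolution and a viscosity supersolution in $\Omega$ of $\mathscr{F}(p,f,\nabla_{\mathscr{H}}f,\nabla^2_{\mathscr{H}}f)=0$, and $u\le v$ on $\partial\Omega$, then $u\le v$ in $\overline{\Omega}$. Let $f\in C(\overline{\Omega})$ be a viscosity solution of the problem $$\mathscr{F}\big(p,f,\nabla_{\mathscr{H}}f,\nabla^2_{\mathscr{H}}f\big)=0\ \text{ in }\Omega,\qquad 0\le f\le 1\ \text{ in }\Omega,\qquad f=0\ \text{ on }\partial\Omega_0,\qquad f=1\ \text{ in }\overline{\Omega}_1,$$ where $f$ is regarded as a function on $\overline{\Omega}_0$ by extending it with the value $1$ on $\overline{\Omega}_1$. Then, for every $\ell\in(0,1)$, the superlevel set $$\Omega_\ell=\{p\in\overline{\Omega}_0 \mid f(p)\ge\ell\}$$ is starshaped with respect to $p_0$.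
   Context: Carnot group: a simply-connected real Lie group $(\mathbb{G},\circ)$ with identity $e$ whose Lie algebra $\mathfrak{g}$ is stratified and $k$-nilpotent: $\mathfrak{g}=\mathfrak{g}_1\oplus\dots\oplus\mathfrak{g}_k$ with $[\mathfrak{g}_1,\mathfrak{g}_j]=\mathfrak{g}_{j+1}$ for $j=1,\dots,k-1$ and $[\mathfrak{g}_1,\mathfrak{g}_k]=\{0\}$; $k$ is the step, and $k\ge 2$ is assumed throughout. The exponential map $\exp:\mathfrak{g}\to\mathbb{G}$ is a global diffeomorphism. The first layer $\mathfrak{g}_1$ is called horizontal and $m=\dim\mathfrak{g}_1$. Dilations: for $\lambda>0$ and $u=u_1+\dots+u_k$ with $u_j\in\mathfrak{g}_j$, $\Delta_\lambda u=\lambda u_1+\lambda^2u_2+\dots+\lambda^ku_k$, and $\delta_\lambda=\exp\circ\Delta_\lambda\circ\exp^{-1}:\mathbb{G}\to\mathbb{G}$; also $\delta_0(p)=e$ for all $p$. Dilations centered at $p_0\in\mathbb{G}$: $\delta^{p_0}_\lambda(p)=p_0\circ\delta_\lambda(p_0^{-1}\circ p)$, so for $\lambda>0$, $(\delta^{p_0}_\lambda)^{-1}(p)=p_0\circ\delta_{1/\lambda}(p_0^{-1}\circ p)$. Starshapedness: a connected set $A\subset\mathbb{G}$ containing $e$ is starshaped (with respect to $e$) if $A=\bigcup_{0\le\lambda\le1}\delta_\lambda(A)$. If $p_0\in A$, $A$ is starshaped with respect to $p_0$ if the left-translate $L_{p_0^{-1}}(A)=\{p_0^{-1}\circ p: p\in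 A\}$ is starshaped with respect to $e$; in particular $\delta^{p_0}_\lambda(p)\in A$ for every $p\in A$ and $0\le\lambda\le1$. Horizontal derivatives: fix an orthonormal basis $\{e_1,\dots,e_m\}$ of $\mathfrak{g}_1$ (for a given inner product) and let $X_j(p)=dL_p(e_j)$ be the associated left-invariant vector fields, where $L_p(p')=p\circ p'$. The horizontal gradient is $\nabla_{\mathscr{H}}f=(X_1f,\dots,X_mf)^T\in\mathbb{R}^m$ and the symmetrized horizontal Hessian is $\nabla^2_{\mathscr{H}}f=\left[\tfrac{1}{2}(X_iX_jf+X_jX_if)\right]_{i,j=1,\dots,m}$. $\mathscr{S}_m(\mathbb{R})$ is the space of real symmetric $m\times m$ matrices with its usual partial order. Viscosity solutions: for $f,\varphi\in C(\Omega)$ and $\bar p\in\Omega$, $\varphi$ touches $f$ from above (resp. below) at $\bar p$ if $\varphi(\bar p)=f(\bar p)$ and $\varphi\ge f$ (resp. $\varphi\le f$) in a neighborhood of $\bar p$. A function $f\in C(\Omega)$ is a viscosity subsolution of $\mathscr{F}(p,f,\nabla_{\mathscr{H}}f,\nabla^2_{\mathscr{H}}f)=0$ at $\bar p$ if for every $\varphi\in C^2(\Omega)$ touching $f$ from above at $\bar p$ one has $\mathscr{F}(\bar p,f(\bar p),\nabla_{\mathscr{H}}\varphi(\bar p),\nabla^2_{\mathscr{H}}\varphi(\bar p))\ge0$; it is a viscosity supersolution at $\bar p$ if for every $\psi\in C^2(\Omega)$ touching $f$ from below at $\bar p$ one has $\mathscr{F}(\bar p,f(\bar p),\nabla_{\mathscr{H}}\psi(\bar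 p),\nabla^2_{\mathscr{H}}\psi(\bar p))\le0$. A viscosity sub/supersolution in $\Omega$ is one at every $\bar p\in\Omega$; a viscosity solution in $\Omega$ is both a subsolution and a supersolution in $\Omega$. A viscosity solution $f\in C(\overline{\Omega})$ of the boundary value problem is a viscosity solution of the equation in $\Omega$ satisfying the remaining conditions pointwise. *)

(* Defs.v *)
From HB Require Import structures.
From mathcomp Require Import all_boot all_order all_algebra.
From mathcomp Require Import all_classical all_reals all_analysis.

Set Implicit Arguments.
Unset Strict Implicit.
Unset Printing Implicit Defensive.

Import Order.TTheory GRing.Theory Num.Theory.
Import numFieldNormedType.Exports.

Local Open Scope classical_set_scope.
Local Open Scope ring_scope.

(* [Ck_on j A f]: f is of class C^j on A.  It is meant for A open and V of
   finite dimension, where the continuity of the differential amounts to the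
   continuity of each directional derivative. *)
Fixpoint Ck_on (R : realType) (V W : normedModType R) (j : nat) (A : set V)
    (f : V -> W) : Prop :=
  match j with
  | 0%N => forall x, A x -> {for x, continuous f}
  | i.+1 => (forall x, A x -> differentiable f x) /\
            (forall v, Ck_on i A (fun x => 'D_v f x))
  end.

Definition smooth (R : realType) (V W : normedModType R) (f : V -> W) : Prop :=
  forall j, Ck_on j setT f.

(* No compatibility between the group law and the topology is required here:
   in [expLieGroup] it follows from the smoothness of the operations. *)
#[short(type="preTopologicalGroupType")]
HB.structure Definition PreTopologicalGroup := {G of Topological G & Group G}.

(* The derivative of phi at p along dL_p(v), where v is a tangent vector at
   the identity, computed in the chart [expg] around the identity. *)
Definition left_deriv (R : realType) (n : nat) (G : preTopologicalGroupType)
    (expg : 'rV[R]_n -> G) (v : 'rV[R]_n) (phi : G -> R) (p : G) : R :=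
  'D_v (fun w => phi (p * expg w)%g) 0.

(* A real Lie group of dimension n whose exponential map is a global
   diffeomorphism.  A basis of the Lie algebra has been fixed, so that the Lie
   algebra is 'rV[R]_n with bracket [lieb].  The manifold structure is the one
   for which [expg] is a diffeomorphism; in particular G is homeomorphic to
   R^n, hence simply connected.  By [expg_param], t |-> expg (t *: u) is the
   one-parameter subgroup with velocity u at the identity.  The bracket is the
   commutator of left-invariant vector fields, see [liebP]. *)
Record expLieGroup (R : realType) (n : nat) := ExpLieGroup {
  lie_sort :> preTopologicalGroupType ;
  expg : 'rV[R]_n -> lie_sort ;
  logg : lie_sort -> 'rV[R]_n ;
  expgK : cancel expg logg ;
  loggK : cancel logg expg ;
  expg_continuous : continuous expg ;
  logg_continuous : continuous logg ;
  mulg_smooth : smooth (fun uv : 'rV[R]_n * 'rV[R]_n =>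
                          logg (expg uv.1 * expg uv.2)%g) ;
  invg_smooth : smooth (fun u => logg (expg u)^-1%g) ;
  expg_param : forall (s t : R) u,
    expg ((s + t) *: u) = (expg (s *: u) * expg (t *: u))%g ;
  lieb : 'rV[R]_n -> 'rV[R]_n -> 'rV[R]_n ;
  liebP : forall u v (phi : lie_sort -> R), smooth (phi \o expg) ->
    forall p,
      left_deriv expg u (left_deriv expg v phi) p
      - left_deriv expg v (left_deriv expg u phi) p
      = left_deriv expg (lieb u v) phi p
}.
Arguments expg {R n} _ _.
Arguments logg {R n} _ _.
Arguments lieb {R n} _ _ _.

(* The span [U, V] of the brackets of elements of U and V; since the bracket
   is bilinear it is enough to span by the brackets of basis vectors (compare
   [prodv] for the product of subspaces of an algebra). *)
Definition liebv (R : realType) (n : nat) (G : expLieGroup R n)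
    (U V : {vspace 'rV[R]_n}) : {vspace 'rV[R]_n} :=
  <<[seq lieb G u v | u <- vbasis U, v <- vbasis V]>>%VS.

(* Carnot groups of step k: [layer j] is g_j for 1 <= j <= k, and its values
   at other indices are irrelevant. *)
Record carnotGroup (R : realType) (n k : nat) := CarnotGroup {
  carnot_lie :> expLieGroup R n ;
  layer : nat -> {vspace 'rV[R]_n} ;
  layer_direct : directv (\sum_(j < k) layer j.+1) ;
  layer_full : (\sum_(j < k) layer j.+1)%VS = fullv ;
  layer_lieb : forall j, (0 < j < k)%N ->
    liebv carnot_lie (layer 1) (layer j) = layer j.+1 ;
  layer_lieb_last : liebv carnot_lie (layer 1) (layer k) = 0%VS ;
  layer_last_neq0 : layer k != 0%VS
}.
Arguments layer {R n k} _ _.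

Definition alg_dil (R : realType) (n k : nat) (G : carnotGroup R n k)
    (l : R) (u : 'rV[R]_n) : 'rV[R]_n :=
  \sum_(j < k) l ^+ j.+1 *: sumv_pi (\sum_(i < k) layer G i.+1)%VS j u.

(* For l = 0 this is the constant map with value the identity. *)
Definition dil (R : realType) (n k : nat) (G : carnotGroup R n k)
    (l : R) (p : G) : G :=
  expg G (alg_dil G l (logg G p)).

(* For 0 < l the inverse of [dil_at p0 l] is [dil_at p0 l^-1]. *)
Definition dil_at (R : realType) (n k : nat) (G : carnotGroup R n k)
    (p0 : G) (l : R) (p : G) : G :=
  (p0 * dil l (p0^-1 * p))%g.

Definition starshaped (R : realType) (n k : nat) (G : carnotGroup R n k)
    (A : set G) : Prop :=
  [/\ connected A, A 1%g
    & A = \bigcup_(l in [set l : R | 0 <= l <= 1]) (dil l @` A)].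

Definition starshaped_at (R : realType) (n k : nat) (G : carnotGroup R n k)
    (p0 : G) (A : set G) : Prop :=
  A p0 /\ starshaped ((fun p : G => p0^-1 * p)%g @` A).

Definition boundary (T : topologicalType) (A : set T) : set T :=
  closure A `\` interior A.

(* Boundedness is read in exponential coordinates; it agrees with boundedness
   for any homogeneous or Carnot-Caratheodory distance. *)
Definition bounded_in (R : realType) (n : nat) (G : expLieGroup R n)
    (A : set G) : Prop :=
  bounded_set (logg G @` A).

Definition condenser (R : realType) (n : nat) (G : expLieGroup R n)
    (O0 O1 : set G) : Prop :=
  [/\ [/\ connected O0, bounded_in O0 & open O0],
      [/\ connected O1, bounded_in O1 & open O1]
    & closure O1 `<=` O0].

Definition horizontal_basis (R : realType) (n k : nat) (G : carnotGroup R n k)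
    (m : nat) (ip : {dot 'rV[R]_n for idfun}) (e : m.-tuple 'rV[R]_n) : Prop :=
  basis_of (layer G 1) e /\ orthonormal ip e.

Definition hfield (R : realType) (n : nat) (G : expLieGroup R n) (m : nat)
    (e : m.-tuple 'rV[R]_n) (j : 'I_m) (phi : G -> R) : G -> R :=
  left_deriv (expg G) (tnth e j) phi.

Definition hgrad (R : realType) (n : nat) (G : expLieGroup R n) (m : nat)
    (e : m.-tuple 'rV[R]_n) (phi : G -> R) (p : G) : 'cV[R]_m :=
  \col_j hfield e j phi p.

Definition hhess (R : realType) (n : nat) (G : expLieGroup R n) (m : nat)
    (e : m.-tuple 'rV[R]_n) (phi : G -> R) (p : G) : 'M[R]_m :=
  \matrix_(i, j) (2^-1 * (hfield e i (hfield e j phi) p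
                          + hfield e j (hfield e i phi) p)).

Definition symmx (R : realType) (m : nat) (M : 'M[R]_m) : Prop := M^T = M.

Definition lesymmx (R : realType) (m : nat) (M N : 'M[R]_m) : Prop :=
  forall x : 'cV[R]_m, (x^T *m M *m x) 0 0 <= (x^T *m N *m x) 0 0.

Definition C2_on (R : realType) (n : nat) (G : expLieGroup R n)
    (O : set G) (phi : G -> R) : Prop :=
  Ck_on 2 (expg G @^-1` O) (phi \o expg G).

Definition touches_above (R : realType) (T : topologicalType)
    (phi f : T -> R) (p : T) : Prop :=
  phi p = f p /\ \forall q \near p, f q <= phi q.

Definition touches_below (R : realType) (T : topologicalType)
    (phi f : T -> R) (p : T) : Prop :=
  phi p = f p /\ \forall q \near p, phi q <= f q.

(* The matrix argument of F ranges over all square matrices, but F is only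
   ever evaluated at, and constrained on, symmetric ones.  Likewise functions
   on a subset of G are represented by total functions whose values outside
   that subset play no role. *)
Definition viscosity_subsolution (R : realType) (n : nat) (G : expLieGroup R n)
    (m : nat) (e : m.-tuple 'rV[R]_n)
    (F : G -> R -> 'cV[R]_m -> 'M[R]_m -> R) (O : set G) (f : G -> R) : Prop :=
  {within O, continuous f} /\
  forall p, O p -> forall phi : G -> R, C2_on O phi -> touches_above phi f p ->
    0 <= F p (f p) (hgrad e phi p) (hhess e phi p).

Definition viscosity_supersolution (R : realType) (n : nat)
    (G : expLieGroup R n) (m : nat) (e : m.-tuple 'rV[R]_n)
    (F : G -> R -> 'cV[R]_m -> 'M[R]_m -> R) (O : set G) (f : G -> R) : Prop :=
  {within O, continuous f} /\
  forall p, O p -> forall psi : G -> R, C2_on O psi -> touches_below psi f p ->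
    F p (f p) (hgrad e psi p) (hhess e psi p) <= 0.

Definition viscosity_solution (R : realType) (n : nat) (G : expLieGroup R n)
    (m : nat) (e : m.-tuple 'rV[R]_n)
    (F : G -> R -> 'cV[R]_m -> 'M[R]_m -> R) (O : set G) (f : G -> R) : Prop :=
  viscosity_subsolution e F O f /\ viscosity_supersolution e F O f.

(* Main.v *)
From HB Require Import structures.
Require Import Defs.
From mathcomp Require Import all_boot all_order all_algebra.
From mathcomp Require Import all_classical all_reals all_analysis.
From mathcomp Require Import ring lra.
Import Order.TTheory GRing.Theory Num.Theory.
Import numFieldNormedType.Exports.
Local Open Scope classical_set_scope.
Local Open Scope ring_scope.
Set Implicit Arguments.
Unset Strict Implicit.
Unset Printing Implicit Defensive.

(** Write [D s] for the dilation of ratio [s] centred at [p0].  The superlevel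
    sets of [f] are stable under contractions, hence starshaped, as soon as
    [f (D s p) <= f p] for all [s >= 1] and all [p] in [O], where [f] is
    extended by 0 outside [O0].  Let [w] be the maximum of [f] and [f \o D s].
    The comparison principle yields [w <= f], which is this inequality, once
    [w] is known to be a subsolution lying below [f] on the boundary of [O].

    On the boundary of [O0] the point [D s p] is outside [O0], because [O0] is
    starshaped, so [w] vanishes there together with [f]; on the boundary of
    [O1] one has [w <= 1 = f].  For the subsolution property consider a test
    function that touches [w] from above at [p].  If [w p = f p] it also
    touches [f] from above.  Otherwise [f (D s p) > f p >= 0], so [D s p] is in
    [O0]; it is not in the closure of [O1], which is starshaped and does not
    contain [p]; hence [D s p] is in [O], the test function moved by [D s^-1]
    touches [f] from above there, and the scaling hypothesis carries the
    inequality for [f] at [D s p] back to [p] ([dilated_subsolution]).  Taking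
    the maximum with [f] is what makes the extension by 0 harmless: the zero
    function is not assumed to be a subsolution.

    Two ingredients take most of the work.

    The first is that horizontal derivatives are homogeneous,
    [X (phi \o D s) = s * (X phi \o D s)].  Dilations are defined on the Lie
    algebra, so their effect on left-invariant fields has to be derived from
    the bracket.  They respect the bracket ([alg_dil_lieb]), by the Jacobi
    identity and because the first layer generates.  And every Lie algebra
    endomorphism [A] maps left-invariant fields, written in exponential
    coordinates, to left-invariant fields ([lfield_lie_hom]): along the ray
    through [x] the coordinates of a constant field [y] in the left-invariant
    frame, multiplied by the time, solve [Z' = y - [x, Z]] with [Z 0 = 0]
    ([lcofield_ode]), an equation that [A] preserves and whose solution is
    unique ([linear_ode_unique]).

    The second is that a test function has to be of class C^2 on all of [O],
    whereas a test function moved by a dilation is so only on a part of it.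
    [C2_localization] repairs this without changing the function near the point
    of contact: it precomposes with a C^2 map that is the identity near that
    point and takes its values in a small cube. *)

(** * Functions of class C^j *)

Section Ck.
Context {R : realType}.
Implicit Types V W : normedModType R.

Lemma near_eq_differentiable V W (f g : V -> W) (a : V) :
  (\near a, f a = g a) -> differentiable f a -> differentiable g a.
Proof.
move=> fg df.
have -> : g = f + (g - f) by apply/funext => x; rewrite !fctE addrC subrK.
apply: differentiableD => //.
pose z : {linear V -> W} := \0.
have fga : f a = g a by exact: nbhs_singleton fg.
have h0 : (g - f) \o shift a = cst ((g - f) a) + z +o_ 0 id.
  apply/eqaddoE/eqaddoP => e e0 /=.
  have : \forall x \near 0, f (x + a) = g (x + a).
    by move: fg; rewrite (near_shift 0) subr0.
  apply: filterS => x fgx; rewrite /z/= !fctE/= fgx fga !subrr.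
  by rewrite addr0 subr0 normr0 mulr_ge0// ltW.
have z0 : continuous z by move=> x; exact: cst_continuous.
have dz := diff_unique z0 h0.
by apply/diff_locallyP; split; [rewrite dz|rewrite h0 dz].
Qed.

Lemma Ck_on_subset V W j (A B : set V) (f : V -> W) :
  A `<=` B -> Ck_on j B f -> Ck_on j A f.
Proof.
elim: j f => [|j IH] f AB /=; first by move=> Bf x /AB; exact: Bf.
by move=> [df Df]; split=> [x /AB|v]; [exact: df|apply: IH].
Qed.

Lemma Ck_on_ext V W j (A : set V) (f g : V -> W) : open A ->
  (forall x, A x -> f x = g x) -> Ck_on j A f -> Ck_on j A g.
Proof.
move=> oA; elim: j f g => [|j IH] f g fg.
  move=> cf x Ax; apply: (@cvg_trans _ (f @ x)); last by rewrite -fg//; exact: cf.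
  by apply: near_eq_cvg; move: (oA); rewrite openE => /(_ _ Ax); apply: filterS.
have nfg x : A x -> \near x, f x = g x.
  by move=> Ax; move: (oA); rewrite openE => /(_ _ Ax); apply: filterS.
move=> [df Df]; split=> [x Ax|v].
  exact: near_eq_differentiable (nfg _ Ax) (df _ Ax).
apply: IH (Df v) => x Ax; exact: near_eq_derive (nfg _ Ax).
Qed.

Lemma Ck_on_lower V W j (A : set V) (f : V -> W) : Ck_on j.+1 A f -> Ck_on j A f.
Proof.
elim: j f => [|j IH] f [df Df].
  by move=> x /df; exact: differentiable_continuous.
by split=> // v; exact/IH/Df.
Qed.

Lemma Ck_on_cst V W j (A : set V) (c : W) : Ck_on j A (cst c).
Proof.
elim: j c => [|j IH] c /=; first by move=> x _; exact: cst_continuous.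
split=> // v; have -> : (fun x => 'D_v (cst c : V -> W) x) = cst 0; last exact: IH.
by apply/funext => x; rewrite derive_cst.
Qed.

Lemma Ck_on_linear_comp V W W' j (A : set V) (L : {linear W -> W'}) (f : V -> W) :
  open A -> continuous L -> Ck_on j A f -> Ck_on j A (L \o f).
Proof.
move=> oA cL; elim: j f => [|j IH] f.
  by move=> cf x Ax; apply: continuous_comp; [exact: cf|exact: cL].
move=> [df Df]; have dL y : differentiable L y by exact: linear_differentiable.
split=> [x Ax|v]; first by apply: differentiable_comp; [exact: df|].
apply: (@Ck_on_ext _ _ _ _ (L \o 'D_v f)) => //; last exact: (IH _ (Df v)).
move=> x Ax; have dfx := df x Ax.
rewrite [RHS]deriveE; last exact: differentiable_comp.
by rewrite diff_comp//= diff_lin// deriveE.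
Qed.

Lemma Ck_onD V W j (A : set V) (f g : V -> W) : open A ->
  Ck_on j A f -> Ck_on j A g -> Ck_on j A (f + g).
Proof.
move=> oA; elim: j f g => [|j IH] f g.
  by move=> cf cg x Ax; apply: continuousD; [exact: cf|exact: cg].
move=> [df Df] [dg Dg]; split=> [x Ax|v].
  by apply: differentiableD; [exact: df|exact: dg].
apply: (@Ck_on_ext _ _ _ _ ('D_v f + 'D_v g)) => //; last first.
  by apply: IH; [exact: Df|exact: Dg].
by move=> x Ax; rewrite deriveD//; [exact/diff_derivable/df|exact/diff_derivable/dg].
Qed.

Lemma Ck_on_sum V W j (A : set V) n (f : 'I_n -> V -> W) : open A ->
  (forall i, Ck_on j A (f i)) -> Ck_on j A (\sum_i f i).
Proof.
move=> oA cf; elim/big_ind : _ => //; first exact: Ck_on_cst.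
by move=> *; exact: Ck_onD.
Qed.

Lemma Ck_onM V j (A : set V) (f g : V -> R) : open A ->
  Ck_on j A f -> Ck_on j A g -> Ck_on j A (f * g).
Proof.
move=> oA; elim: j f g => [|j IH] f g.
  by move=> cf cg x Ax; apply: continuousM; [exact: cf|exact: cg].
move=> Cf Cg; have [[df Df] [dg Dg]] := (Cf, Cg).
split=> [x Ax|v].
  by apply: differentiableM; [exact: df|exact: dg].
apply: (@Ck_on_ext _ _ _ _ (f * 'D_v g + g * 'D_v f)) => //; last first.
  by apply: Ck_onD => //; apply: IH;
    [exact: Ck_on_lower|exact: Dg|exact: Ck_on_lower|exact: Df].
by move=> x Ax; rewrite deriveM//; [exact/diff_derivable/df|exact/diff_derivable/dg].
Qed.

Definition mklinear (V W : lmodType R) (f : V -> W) (lf : linear f) :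
  {linear V -> W} := HB.pack f (GRing.isLinear.Build _ _ _ _ _ lf).

Lemma mklinearE (V W : lmodType R) (f : V -> W) (lf : linear f) x :
  mklinear lf x = f x.
Proof. by []. Qed.

Lemma coord_linear m n (i : 'I_m) (j : 'I_n) :
  linear (fun M : 'M[R]_(m, n) => M i j : R).
Proof. by move=> a M N; rewrite !mxE. Qed.

Definition coord_lin m n i j : {linear 'M[R]_(m, n) -> R} :=
  mklinear (@coord_linear m n i j).

Lemma scalel_linear (V : lmodType R) (x : V) : linear (fun c : R => c *: x).
Proof. by move=> a b c; rewrite scalerDl scalerA. Qed.

Definition line_lin (V : lmodType R) (x : V) : {linear R -> V} :=
  mklinear (scalel_linear x).

Lemma line_lin_continuous V (x : V) : continuous (line_lin x).
Proof. exact: scalel_continuous. Qed.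

Lemma Ck_on_coord V j (A : set V) n (f : V -> 'rV[R]_n) i : open A ->
  Ck_on j A f -> Ck_on j A (fun x => f x 0 i).
Proof.
move=> oA; apply: (@Ck_on_linear_comp _ _ _ _ _ (coord_lin 0 i)) => //.
exact: coord_continuous.
Qed.

Lemma Ck_on_rV V j (A : set V) n (f : V -> 'rV[R]_n) : open A ->
  (forall i, Ck_on j A (fun x => f x 0 i)) -> Ck_on j A f.
Proof.
move=> oA cf.
have -> : f = \sum_i (line_lin (delta_mx 0 i) \o (fun x => f x 0 i)).
  by apply/funext => x; rewrite fct_sumE/= [LHS]row_sum_delta.
apply: Ck_on_sum => // i; apply: Ck_on_linear_comp => //.
exact: line_lin_continuous.
Qed.

(** The two difference quotients are the same function. *)
Lemma derive_comp_affine V W W' (L : {linear V -> W}) (c : W) (f : W -> W') a v :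
  'D_v (fun x => f (L x + c)) a = 'D_(L v) f (L a + c).
Proof.
pose q (V' : normedModType R) (g : V' -> W') b u (h : R) : W' :=
  h^-1 *: ((g \o shift b) (h *: u) - g b).
suff E : q V (fun x => f (L x + c)) a v = q W f (L a + c) (L v).
  by rewrite /derive -/(q V _ a v) E.
by apply/funext => h; rewrite /q/= (linearD L) (linearZ_LR L) addrA.
Qed.

Lemma Ck_on_comp_affine V W W' j (B : set W) (L : {linear V -> W}) (c : W)
    (f : W -> W') : continuous L -> open B -> Ck_on j B f ->
  Ck_on j [set x | B (L x + c)] (fun x => f (L x + c)).
Proof.
move=> cL oB; have cg : continuous (fun x => L x + c).
  by move=> x; apply: continuousD; [exact: cL|exact: cst_continuous].
have oA : open [set x | B (L x + c)] by move: oB; apply: open_comp.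
elim: j f => [|j IH] f.
  by move=> cf x Ax; apply: (@continuous_comp _ _ _ (fun x => L x + c));
    [exact: cg|exact: cf].
have dg x : is_diff x (fun x => L x + c) L.
  have dL : is_diff x L L.
    by apply: DiffDef; [exact: linear_differentiable|rewrite diff_lin].
  have -> : (fun x => L x + c) = (L : V -> W) + cst c by [].
  by apply: is_diff_eq; rewrite addr0.
move=> [df Df]; split=> [x Ax|v].
  by apply: (@differentiable_comp _ _ _ _ (fun x => L x + c)) => //; exact: df.
have -> : 'D_v (fun x => f (L x + c)) = (fun x => 'D_(L v) f (L x + c)).
  by apply/funext => x; exact: (derive_comp_affine L c f).
exact: (IH ('D_(L v) f) (Df _)).
Qed.

Lemma derive_comp V n (f : 'rV[R]_n -> R) (g : V -> 'rV[R]_n) x v :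
  differentiable g x -> differentiable f (g x) ->
  'D_v (f \o g) x = \sum_i ('D_v g x) 0 i * 'D_(delta_mx 0 i) f (g x).
Proof.
move=> dg df; rewrite deriveE; last exact: differentiable_comp.
rewrite diff_comp//= -(deriveE v dg) [X in 'd _ _ X]row_sum_delta linear_sum.
by apply: eq_bigr => i _; rewrite linearZ/= (deriveE _ df).
Qed.

(** Induction on [j]: by the chain rule the derivatives of [f \o g] are sums of
    products of derivatives of [g] with partial derivatives of [f] composed
    with [g], and these composites are covered by the induction hypothesis. *)
Lemma Ck_on_comp V n j (A : set V) (B : set 'rV[R]_n)
    (g : V -> 'rV[R]_n) (f : 'rV[R]_n -> R) :
  open A -> open B -> (forall x, A x -> B (g x)) ->
  Ck_on j A g -> Ck_on j B f -> Ck_on j A (f \o g).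
Proof.
move=> oA oB AB; elim: j f => [|j IH] f.
  by move=> cg cf x Ax; apply: continuous_comp; [exact: cg|exact/cf/AB].
move=> Cg [df Df]; have [dg Dg] := Cg; split=> [x Ax|v].
  by apply: differentiable_comp; [exact: dg|exact/df/AB].
apply: (@Ck_on_ext _ _ _ _
  (\sum_i ((fun x => 'D_v g x 0 i) * ('D_(delta_mx 0 i) f \o g)))) => //.
  by move=> x Ax; rewrite fct_sumE derive_comp//; [exact: dg|exact/df/AB].
apply: Ck_on_sum => // i; apply: Ck_onM => //; first exact: (Ck_on_coord i oA (Dg v)).
by apply: IH; [exact: Ck_on_lower|exact: Df].
Qed.

End Ck.

(** * Localisation of C^2 functions *)

Section Truncation.
Context {R : realType}.

Lemma Ck_on_is_derive j (f df : R -> R) :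
  (forall t : R, is_derive t (1 : R) f (df t)) -> Ck_on j setT df -> Ck_on j.+1 setT f.
Proof.
move=> fdf Cdf; have dff t : differentiable f t.
  by apply/derivable1_diffP; case: (fdf t).
split=> // v; apply: (@Ck_on_ext _ _ _ _ _ (cst v * df)); first exact: openT.
  move=> t _; rewrite [RHS]deriveE// -[X in 'd _ _ X]mulr1 [RHS]linearZ/=.
  by rewrite -deriveE//; case: (fdf t) => _ ->.
by apply: Ck_onM; [exact: openT|exact: Ck_on_cst|].
Qed.

Definition cube_pos (t : R) : R := Num.max t 0 ^+ 3.

Lemma continuous_pos : continuous (fun t : R => Num.max t 0).
Proof. by move=> t; apply: continuous_max; [exact: cvg_id|exact: cst_continuous]. Qed.

Lemma is_derive_pos (k : nat) (t : R) :
  is_derive t (1 : R) (fun t : R => Num.max t 0 ^+ k.+2) (k.+2%:R * Num.max t 0 ^+ k.+1).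
Proof.
have [t0|t0|->] := ltgtP t 0.
- rewrite expr0n/= mulr0.
  apply: (near_eq_is_derive (f := cst (0 : R) : R -> R)).
  near=> s; rewrite max_r ?expr0n//= ltW//.
  by near: s; exact: lt_nbhsl.
- have dX : is_derive t (1 : R) (fun s : R => s ^+ k.+2) (k.+2%:R * t ^+ k.+1).
    have -> : (fun s : R => s ^+ k.+2) = id ^+ k.+2.
      by apply/funext => s; rewrite exprfctE.
    by apply: is_derive_eq; rewrite /GRing.scale/= mulr1.
  apply: near_eq_is_derive dX; near=> s; rewrite max_l// ltW//.
  by near: s; exact: lt_nbhsr.
- rewrite expr0n mulr0.
  pose f (t : R) : R := Num.max t 0 ^+ k.+2.
  have cv : h^-1 *: (f (h *: (1 : R) + 0) - f 0) @[h --> (0 : R)^'] --> (0 : R).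
    have c0 : Num.max h 0 ^+ k.+1 @[h --> (0 : R)^'] --> (0 : R).
      have cX : continuous (fun h : R => Num.max h 0 ^+ k.+1).
        move=> h; apply: (@continuous_comp R R R (fun h => Num.max h 0)
          (fun x => x ^+ k.+1)).
          exact: continuous_pos.
        exact: exprn_continuous.
      have := cX 0; rewrite /prop_for/continuous_at maxxx expr0n/=.
      by apply: cvg_trans; apply: cvg_app; exact: nbhs_dnbhs.
    apply: cvg_trans c0; apply: near_eq_cvg; near=> h.
    have h0 : h != 0 by near: h; exact: nbhs_dnbhs_neq.
    rewrite /f addr0 /GRing.scale/= mulr1 maxxx expr0n subr0.
    have [h1|h1] := leP h 0; first by rewrite !expr0n mulr0.
    by rewrite [in RHS]exprS mulKf.
  apply: DeriveDef; first by apply/cvg_ex; exists 0.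
  exact/cvg_lim.
Unshelve. all: by end_near. Qed.

(** The cubic spline that is the identity on [-1, 1] and is equal to 2 on
    [3, +oo[ and to -2 on ]-oo, -3]; its second derivative is continuous and
    piecewise linear, with knots 1, 2, 3 and their opposites. *)
Definition trunc (t : R) : R :=
  let s u := (cube_pos (u - 1) - 2 * cube_pos (u - 2) + cube_pos (u - 3)) / 6 in
  t - s t + s (- t).

Lemma truncN t : trunc (- t) = - trunc t.
Proof. rewrite /trunc opprK; ring. Qed.

Lemma trunc_ge0 t : 0 <= t -> 0 <= trunc t <= 2.
Proof.
move=> t0; rewrite /trunc /cube_pos.
rewrite (max_r (x := - t - 1)); last by lra.
rewrite (max_r (x := - t - 2)); last by lra.
rewrite (max_r (x := - t - 3)); last by lra.
have [t1|t1] := leP t 1.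
  rewrite !max_r; try lra; rewrite !expr0n/=; lra.
rewrite (max_l (x := t - 1)); last by lra.
have [t2|t2] := leP t 2.
  rewrite !max_r; try lra; rewrite !expr0n/=.
  have u0 : 0 <= (t - 1) ^+ 3 by apply: exprn_ge0; lra.
  have u1 : (t - 1) ^+ 3 <= t - 1.
    by rewrite -[leRHS]expr1 ler_wiXn2l//; lra.
  lra.
rewrite (max_l (x := t - 2)); last by lra.
have [t3|t3] := leP t 3.
  rewrite !max_r; try lra; rewrite !expr0n/=.
  have : 0 <= (3 - t) ^+ 3 by apply: exprn_ge0; lra.
  have : (3 - t) ^+ 3 <= 1 by apply: exprn_ile1; lra.
  nra.
rewrite (max_l (x := t - 3)); last by lra.
rewrite !expr0n/=; nra.
Qed.

Lemma trunc_bound t : `|trunc t| <= 2.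
Proof.
have [/trunc_ge0|t0] := leP 0 t; first by rewrite ler_norml; lra.
have : 0 <= - t by lra.
by move=> /trunc_ge0; rewrite truncN ler_norml; lra.
Qed.

Lemma trunc_id t : `|t| <= 1 -> trunc t = t.
Proof.
rewrite ler_norml => t1; rewrite /trunc /cube_pos !max_r ?expr0n/=; lra.
Qed.

Lemma Ck_on_cube_pos : Ck_on 2 setT cube_pos.
Proof.
have C1 : Ck_on 1 setT (fun t : R => Num.max t 0 ^+ 2).
  apply: (Ck_on_is_derive (is_derive_pos 0)).
  apply: (@Ck_onM _ _ _ _ (cst 2)); [exact: openT|exact: Ck_on_cst|].
  by move=> t _; exact: continuous_pos.
apply: (Ck_on_is_derive (is_derive_pos 1)).
by apply: (@Ck_onM _ _ _ _ (cst 3)); [exact: openT|exact: Ck_on_cst|].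
Qed.

Lemma Ck_on_comp_affineT (V W W' : normedModType R) j (L : {linear V -> W}) (c : W)
    (f : W -> W') : continuous L -> Ck_on j setT f ->
  Ck_on j setT (fun x => f (L x + c)).
Proof.
move=> cL Cf; apply: Ck_on_subset (Ck_on_comp_affine c cL openT Cf).
by move=> x _.
Qed.

Lemma Ck_on_id j : Ck_on j setT (@id R).
Proof.
case: j => [t _|j]; first exact: cvg_id.
by apply: (@Ck_on_is_derive _ _ (cst 1)); exact: Ck_on_cst.
Qed.

Lemma Ck_on_trunc j : Ck_on j setT cube_pos -> Ck_on j setT trunc.
Proof.
move=> Ccube; have oT : open [set: R] by exact: openT.
have Ccst c : Ck_on j setT (cst c : R -> R) by exact: Ck_on_cst.
have Cp c : Ck_on j setT (fun t => cube_pos (t + c)).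
  have cid : continuous (@idfun R) by move=> x; exact: cvg_id.
  exact: (@Ck_on_comp_affineT _ _ _ j idfun c _ cid Ccube).
pose s u := (cube_pos (u - 1) - 2 * cube_pos (u - 2) + cube_pos (u - 3)) / 6.
have Cs : Ck_on j setT s.
  have -> : s = cst 6^-1 * ((fun t => cube_pos (t + - 1)) +
     (cst (- 2) * (fun t => cube_pos (t + - 2)) + (fun t => cube_pos (t + - 3)))).
    by apply/funext => t; rewrite /s !fctE; ring.
  apply: (Ck_onM oT (Ccst _)); apply: (Ck_onD oT (Cp _)).
  by apply: (Ck_onD oT _ (Cp _)); exact: (Ck_onM oT (Ccst _) (Cp _)).
have -> : trunc = id + (cst (- 1) * s + (fun t => s ( *:%R (- 1) t + 0))).
  apply/funext => t; rewrite /trunc !fctE -/(s _) -/(s (- t)) addr0 scaleN1r; ring.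
apply: (Ck_onD oT (Ck_on_id j)).
apply: (Ck_onD oT); first exact: (Ck_onM oT (Ccst _) Cs).
apply: Ck_on_comp_affineT Cs; exact: scaler_continuous.
Qed.

(** Truncating the coordinates of [x - x0] at scale [r] does not move the points
    near [x0] and sends the whole space into a cube contained in [A]. *)
Lemma Ck_localization j n (A : set 'rV[R]_n) (x0 : 'rV[R]_n) (f : 'rV[R]_n -> R) :
  Ck_on j setT trunc -> open A -> A x0 -> Ck_on j A f ->
  exists2 g, Ck_on j setT g & \forall x \near x0, g x = f x.
Proof.
move=> Ctrunc oA Ax0 Cf.
have /nbhs_ballP[e/= e0 eA] : nbhs x0 A by move: oA; rewrite openE; exact.
pose r := e / 4; have r0 : 0 < r by rewrite divr_gt0.
pose c (x : 'rV[R]_n) : 'rV[R]_n :=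
  \row_i (x0 0 i + r * trunc (r^-1 * (x 0 i - x0 0 i))).
have Cc : Ck_on j setT c.
  apply: Ck_on_rV => [|i]; first exact: openT.
  pose h (s : R) := x0 0 i + r * trunc (r^-1 *: s + 0).
  have Ch : Ck_on j setT h.
    have -> : h = cst (x0 0 i) + cst r * (fun s => trunc (r^-1 *: s + 0)) by [].
    apply: Ck_onD; [exact: openT|exact: Ck_on_cst|].
    apply: Ck_onM; [exact: openT|exact: Ck_on_cst|].
    by apply: Ck_on_comp_affineT; [exact: scaler_continuous|].
  have -> : (fun x => c x 0 i) = (fun x => h (coord_lin 0 i x + - x0 0 i)).
    by apply/funext => x; rewrite mxE /h addr0.
  by apply: Ck_on_comp_affineT; [exact: coord_continuous|].
have cA x : A (c x).
  apply: eA; rewrite -ball_normE/= /Num.Def.normr/= mx_normrE.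
  apply/bigmax_ltP; split=> // -[i l] _ /=; rewrite (ord1 i) !mxE.
  rewrite opprD addrA subrr sub0r normrN normrM (gtr0_norm r0).
  have := trunc_bound (r^-1 * (x 0 l - x0 0 l)).
  by rewrite /r; nra.
exists (f \o c).
  by apply: (@Ck_on_comp _ _ _ _ _ A) => //; exact: openT.
near=> x; congr (f _); apply/rowP => i; rewrite mxE trunc_id.
  by rewrite mulVKf ?gt_eqF// addrC subrK.
rewrite normrM gtr0_norm ?invr_gt0// ler_pdivrMl// mulr1.
have : ball x0 r x by near: x; exact: nbhsx_ballx.
rewrite -ball_normE/= /Num.Def.normr/= mx_normrE => /bigmax_ltP[_ /(_ (0, i) isT)].
by rewrite /= !mxE distrC => /ltW.
Unshelve. all: by end_near. Qed.

Lemma C2_localization n (A : set 'rV[R]_n) (x0 : 'rV[R]_n) (f : 'rV[R]_n -> R) :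
  open A -> A x0 -> Ck_on 2 A f ->
  exists2 g, Ck_on 2 setT g & \forall x \near x0, g x = f x.
Proof. exact: (Ck_localization (Ck_on_trunc Ck_on_cube_pos)). Qed.

End Truncation.

(** * Calculus in coordinates *)

Section Coordinates.
Context {R : realType}.
Implicit Types V W : normedModType R.

Lemma smooth_differentiable V W (f : V -> W) x : smooth f -> differentiable f x.
Proof. by move=> /(_ 1%N)[df _]; exact: df. Qed.

Lemma smooth_derive V W (f : V -> W) v : smooth f -> smooth ('D_v f).
Proof. by move=> Sf j; exact: (Sf j.+1).2. Qed.

Lemma smooth_comp_affine V W W' (L : {linear V -> W}) (c : W) (f : W -> W') :
  continuous L -> smooth f -> smooth (fun x => f (L x + c)).
Proof. by move=> cL Sf j; exact: Ck_on_comp_affineT. Qed.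

Lemma derive_coord V n (f : V -> 'rV[R]_n) a v i : differentiable f a ->
  'D_v (fun x => f x 0 i) a = 'D_v f a 0 i.
Proof. by move=> df; rewrite derive_mx ?mxE//; exact: diff_derivable. Qed.

Lemma differentiable_coord_comp V n (f : V -> 'rV[R]_n) a i :
  differentiable f a -> differentiable (fun x => f x 0 i) a.
Proof.
move=> df; apply: (@differentiable_comp _ _ _ _ f (fun y => y 0 i)) => //.
exact: differentiable_coord.
Qed.

Lemma differentiable_rV V n (f : V -> 'rV[R]_n) a :
  (forall i, differentiable (fun x => f x 0 i) a) -> differentiable f a.
Proof.
move=> df; have -> : f = \sum_i (fun x => f x 0 i *: delta_mx 0 i).
  by apply/funext => x; rewrite fct_sumE/= [LHS]row_sum_delta.
by apply: differentiable_sum => i; exact: differentiableZl.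
Qed.

Lemma linear_rV_continuous n W (L : {linear 'rV[R]_n -> W}) : continuous L.
Proof.
have -> : (L : 'rV[R]_n -> W) = \sum_i (fun x : 'rV[R]_n => x 0 i *: L (delta_mx 0 i)).
  apply/funext => x; rewrite fct_sumE/= [in LHS](row_sum_delta x) linear_sum.
  by apply: eq_bigr => i _; rewrite linearZ.
move=> x; apply: differentiable_continuous; apply: differentiable_sum => i.
by apply: differentiableZl; exact: differentiable_coord.
Qed.

Lemma derive_chain V W W' (f : W -> W') (g : V -> W) x v :
  differentiable g x -> differentiable f (g x) ->
  'D_v (f \o g) x = 'D_('D_v g x) f (g x).
Proof.
move=> dg df; rewrite deriveE; last exact: differentiable_comp.
by rewrite diff_comp//= (deriveE _ df) (deriveE _ dg).
Qed.

Lemma derive_line V W (f : V -> W) a v :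
  'D_v f a = 'D_1 (fun h : R => f (h *: v + a)) 0.
Proof.
by rewrite [RHS](derive_comp_affine (line_lin v) a f) /= scale1r scale0r add0r.
Qed.

Lemma derive_linear V W (f : V -> W) a u v (c : R) : differentiable f a ->
  'D_(c *: u + v) f a = c *: 'D_u f a + 'D_v f a.
Proof. by move=> df; rewrite !deriveE// linearP. Qed.

Lemma is_derive_scale_line n (z : R -> 'rV[R]_n) (t : R) : differentiable z t ->
  is_derive t (1 : R) (fun s : R => s *: z s) (z t + t *: 'D_1 z t).
Proof.
move=> dz; have dzi i := differentiable_coord_comp i dz.
have did : differentiable (id : R -> R) t by exact: ex_diff.
have E i : (fun s : R => (s *: z s) 0 i) = id * (fun s => z s 0 i).
  by apply/funext => s; rewrite mxE.
have df : differentiable (fun s : R => s *: z s) t.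
  by apply: differentiable_rV => i; rewrite E; exact: differentiableM.
apply: DeriveDef; first exact: diff_derivable.
apply/rowP => i; rewrite -derive_coord// E deriveM; try exact: diff_derivable.
by rewrite derive_id !mxE derive_coord// [z t 0 i *: _]mulr1 addrC.
Qed.

(** [X v] is a vector field depending linearly on its parameter [v], and both the
    parameter and the point vary: this is the product rule for the expansion
    [X (c b) (g b) = \sum_i c_i b *: X e_i (g b)]. *)
Lemma derive_linear_family V n (X : 'rV[R]_n -> 'rV[R]_n -> 'rV[R]_n)
    (c g : V -> 'rV[R]_n) a w :
  (forall y, linear (X^~ y)) -> (forall v y, differentiable (X v) y) ->
  differentiable c a -> differentiable g a ->
  'D_w (fun b => X (c b) (g b)) a =
  X ('D_w c a) (g a) + 'D_('D_w g a) (X (c a)) (g a).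
Proof.
move=> LX dX dc dg; pose e i : 'rV[R]_n := delta_mx 0 i.
have XE v y : X v y = \sum_i v 0 i *: X (e i) y.
  rewrite -[LHS]/(mklinear (LX y) v) [in LHS](row_sum_delta v) linear_sum.
  by apply: eq_bigr => i _; rewrite linearZ.
have dci i := differentiable_coord_comp i dc.
have dXg i l : differentiable (fun b => X (e i) (g b) 0 l) a.
  by apply: differentiable_coord_comp; apply: (@differentiable_comp _ _ _ _ g).
have EF l : (fun b => X (c b) (g b) 0 l) =
    \sum_i ((fun b => c b 0 i) * (fun b => X (e i) (g b) 0 l)).
  apply/funext => b; rewrite XE summxE fct_sumE.
  by apply: eq_bigr => i _; rewrite mxE.
have dF : differentiable (fun b => X (c b) (g b)) a.
  apply: differentiable_rV => l; rewrite EF; apply: differentiable_sum => i.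
  exact: differentiableM.
apply/rowP => l; rewrite -derive_coord// EF derive_sum; last first.
  by move=> i; apply: diff_derivable; exact: differentiableM.
have DM i : 'D_w ((fun b => c b 0 i) * (fun b => X (e i) (g b) 0 l)) a =
    c a 0 i *: 'D_w (fun b => X (e i) (g b) 0 l) a +
    X (e i) (g a) 0 l *: 'D_w (fun b => c b 0 i) a.
  by rewrite deriveM//; exact: diff_derivable.
rewrite (eq_bigr _ (fun i _ => DM i)) mxE (XE ('D_w c a)) big_split/= addrC.
congr (_ + _).
  rewrite summxE; apply: eq_bigr => i _; rewrite mxE -derive_coord//.
  by rewrite /GRing.scale/= mulrC.
rewrite -derive_coord//.
have -> : (fun y => X (c a) y 0 l) =
    \sum_i (cst (c a 0 i) * (fun y => X (e i) y 0 l)).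
  apply/funext => y; rewrite XE summxE fct_sumE.
  by apply: eq_bigr => i _; rewrite mxE.
have dXi i y : differentiable (fun y => X (e i) y 0 l) y.
  exact: differentiable_coord_comp.
rewrite derive_sum; last first.
  move=> i; apply: derivableM; first exact: derivable_cst.
  exact: diff_derivable (dXi _ _).
apply: eq_bigr => i _; rewrite deriveMl; last exact: diff_derivable (dXi _ _).
congr (_ * _).
have -> : (fun b => X (e i) (g b) 0 l) = (fun y => X (e i) y 0 l) \o g by [].
by rewrite derive_chain.
Qed.

End Coordinates.

(** * Uniqueness for linear differential equations *)

Section LinearODE.
Context {R : realType}.

(** Gronwall: the squared Euclidean norm [h] of [w] satisfies [h' <= 2 * M * h],
    so [expR (- 2 * M * t) * h t] is nonincreasing; it starts from 0. *)
Lemma linear_ode_unique n (B : {linear 'rV[R]_n -> 'rV[R]_n}) (w : R -> 'rV[R]_n) :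
  (forall t : R, is_derive t (1 : R) w (B (w t))) -> w 0 = 0 -> w 1 = 0.
Proof.
move=> dw w0; pose b i j := B (delta_mx 0 j) 0 i.
have BE v i : B v 0 i = \sum_j v 0 j * b i j.
  rewrite [in LHS](row_sum_delta v) linear_sum summxE.
  by apply: eq_bigr => j _; rewrite linearZ mxE.
have dfw t : differentiable w t by apply/derivable1_diffP; case: (dw t).
have dwi i (t : R) : is_derive t (1 : R) (fun s => w s 0 i) (B (w t) 0 i).
  apply: DeriveDef; last by rewrite derive_coord//; case: (dw t) => _ ->.
  exact/diff_derivable/differentiable_coord_comp.
pose h (t : R) := \sum_i (w t 0 i) ^+ 2.
pose M : R := \sum_i \sum_j `|b i j|.
have h_ge0 t : 0 <= h t by apply: sumr_ge0 => i _; exact: sqr_ge0.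
have wh t i : (w t 0 i) ^+ 2 <= h t.
  by rewrite /h (bigD1 i)//= lerDl sumr_ge0// => j _; exact: sqr_ge0.
have dh (t : R) : is_derive t (1 : R) h (\sum_i 2 * w t 0 i * B (w t) 0 i).
  have -> : h = \sum_i (fun s => w s 0 i) ^+ 2.
    by apply/funext => s; rewrite /h fct_sumE; apply: eq_bigr => i _; rewrite exprfctE.
  by apply: is_derive_sum => i; apply: is_derive_eq.
have hM t : \sum_i 2 * w t 0 i * B (w t) 0 i <= 2 * M * h t.
  rewrite /M mulrAC mulr_sumr; apply: ler_sum => i _.
  rewrite BE mulr_sumr mulr_sumr; apply: ler_sum => j _.
  have wij : `|w t 0 i * w t 0 j| <= h t.
    have := wh t i; have := wh t j; have := sqr_ge0 (w t 0 i - w t 0 j).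
    have := sqr_ge0 (w t 0 i + w t 0 j).
    by rewrite ler_norml; nra.
  rewrite (_ : _ * _ * _ = 2 * ((w t 0 i * w t 0 j) * b i j)); last by ring.
  rewrite (_ : 2 * h t * _ = 2 * (h t * `|b i j|)); last by ring.
  rewrite ler_pM2l//; apply: le_trans (ler_norm _) _; rewrite normrM.
  exact: ler_wpM2r.
pose g (t : R) := expR (- (2 * M) * t) * h t.
have dg (t : R) : is_derive t (1 : R) g (expR (- (2 * M) * t) *
    ((\sum_i 2 * w t 0 i * B (w t) 0 i) - 2 * M * h t)).
  have dE : is_derive t (1 : R) (fun t => expR (- (2 * M) * t))
      (- (2 * M) * expR (- (2 * M) * t)).
    apply: (is_derive_eq (is_derive1_comp _ _)).
    by rewrite [_%:A]mulr1 mulrC.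
  by apply: is_derive_eq; rewrite /GRing.scale/=; ring.
have g10 : g 1 <= g 0.
  apply: (@ler0_derive1_le_cc _ g 0 1) => //.
  - move=> t _; rewrite derive1E; case: (dg t) => _ ->.
    by rewrite pmulr_rle0 ?expR_gt0// subr_le0.
  - apply: derivable_within_continuous => t _; by case: (dg t).
  - by rewrite in_itv/= ler01 lexx.
  - by rewrite in_itv/= ler01 lexx.
have h0 : h 0 = 0.
  by rewrite /h big1// => i _; rewrite w0 mxE expr0n.
have h1 : h 1 = 0.
  apply/eqP; rewrite eq_le h_ge0 andbT.
  by move: g10; rewrite /g h0 mulr0 pmulr_rle0 ?expR_gt0.
apply/rowP => i; rewrite mxE; apply/eqP; rewrite -sqrf_eq0 eq_le sqr_ge0 andbT.
by rewrite -h1.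
Qed.

End LinearODE.

(** * Left-invariant fields in exponential coordinates *)

Section LieGroup.
Context {R : realType} {n : nat} (G : expLieGroup R n).
Local Notation U := ('rV[R]_n).
Local Notation expg := (expg G).
Local Notation logg := (logg G).
Local Notation lieb := (lieb G).

Definition lmul (x y : U) : U := logg (expg x * expg y)%g.

Lemma expg_lmul x y : expg (lmul x y) = (expg x * expg y)%g.
Proof. exact: loggK. Qed.

Lemma expg_zero : expg 0 = 1%g.
Proof.
have := expg_param G 0 0 0; rewrite addr0 scale0r -[X in X = _]mulg1.
by move/mulgI.
Qed.

Lemma lmulA x y z : lmul x (lmul y z) = lmul (lmul x y) z.
Proof. by rewrite /lmul !loggK mulgA. Qed.

Lemma lmul0x x : lmul 0 x = x.
Proof. by rewrite /lmul expg_zero mul1g expgK. Qed.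

Lemma lmulx0 x : lmul x 0 = x.
Proof. by rewrite /lmul expg_zero mulg1 expgK. Qed.

Lemma lmul_line (s t : R) x : lmul (s *: x) (t *: x) = (s + t) *: x.
Proof. by rewrite /lmul -expg_param expgK. Qed.

Lemma lmulNx x : lmul (- x) x = 0.
Proof. by have := lmul_line (- 1) 1 x; rewrite scaleN1r scale1r addNr scale0r. Qed.

Lemma lmulxN x : lmul x (- x) = 0.
Proof. by have := lmul_line 1 (- 1) x; rewrite scaleN1r scale1r addrN scale0r. Qed.

Lemma lmulK x y : lmul (- x) (lmul x y) = y.
Proof. by rewrite lmulA lmulNx lmul0x. Qed.

Lemma lmulVK x y : lmul x (lmul (- x) y) = y.
Proof. by rewrite lmulA lmulxN lmul0x. Qed.

Let pairL_linear : linear (fun x : U => (x, 0) : U * U).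
Proof. by move=> a x y; congr pair; rewrite /= ?scaler0 ?addr0. Qed.
Let pairR_linear : linear (fun x : U => (0, x) : U * U).
Proof. by move=> a x y; congr pair; rewrite /= ?scaler0 ?addr0. Qed.
Let pairN_linear : linear (fun x : U => (- x, x) : U * U).
Proof. by move=> a x y; congr pair; rewrite /= opprD scalerN. Qed.

Let pairL := mklinear pairL_linear.
Let pairR := mklinear pairR_linear.
Let pairN := mklinear pairN_linear.
Let mul2 (uv : U * U) : U := lmul uv.1 uv.2.

Let mul_smooth : smooth mul2.
Proof. exact: mulg_smooth. Qed.

Let lmulE x y : lmul x y = mul2 (pairR y + (x, 0)).
Proof. by rewrite /mul2 mklinearE/= addr0 add0r. Qed.

Lemma lmul_smooth x : smooth (lmul x).
Proof.
have -> : lmul x = fun y => mul2 (pairR y + (x, 0)).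
  by apply/funext => y; exact: lmulE.
by apply: smooth_comp_affine => //; exact: linear_rV_continuous.
Qed.

(** The left-invariant field with value [v] at the identity, in exponential
    coordinates: the point [expg y] is represented by [y]. *)
Definition lfield (v y : U) : U := 'D_v (lmul y) 0.

Let lfieldE v y : lfield v y = 'D_(0, v) mul2 (y, 0).
Proof.
rewrite /lfield (_ : lmul y = fun w => mul2 (pairR w + (y, 0))).
  by rewrite (derive_comp_affine pairR _ mul2) (linear0 pairR) add0r.
by apply/funext => w; exact: lmulE.
Qed.

Lemma lfield_smooth v : smooth (lfield v).
Proof.
have -> : lfield v = fun y => 'D_(0, v) mul2 (pairL y + 0).
  by apply/funext => y; rewrite lfieldE addr0.
have cL : continuous pairL by exact: linear_rV_continuous.
exact: (smooth_comp_affine 0 cL (smooth_derive (0, v) mul_smooth)).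
Qed.

Lemma lfield_differentiable v y : differentiable (lfield v) y.
Proof. exact/smooth_differentiable/lfield_smooth. Qed.

Lemma lfield_linear y : linear (lfield^~ y).
Proof.
by move=> a u v; apply: derive_linear; exact/smooth_differentiable/lmul_smooth.
Qed.

Lemma lfield0 v : lfield v 0 = v.
Proof. by rewrite /lfield (_ : lmul 0 = id) ?derive_id//; apply/funext/lmul0x. Qed.

Lemma left_derivE v (phi : G -> R) y : differentiable (phi \o expg) y ->
  left_deriv expg v phi (expg y) = 'D_(lfield v y) (phi \o expg) y.
Proof.
move=> dphi; have dl := smooth_differentiable 0 (lmul_smooth y).
rewrite /left_deriv (_ : (fun w => _) = (phi \o expg) \o lmul y); last first.
  by apply/funext => w /=; rewrite expg_lmul.
have dphi' : differentiable (phi \o expg) (lmul y 0) by rewrite lmulx0.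
by rewrite (derive_chain v dl dphi') lmulx0.
Qed.

Lemma lfield_derive v y : lfield v y = 'D_v (lmul y) 0.
Proof. by []. Qed.

Opaque lfield.

Lemma left_deriv_Ck j (A : set U) v (phi : G -> R) : open A ->
  Ck_on j.+1 A (phi \o expg) -> Ck_on j A (left_deriv expg v phi \o expg).
Proof.
move=> oA [dphi Dphi]; apply: (@Ck_on_ext _ _ _ _ _
  (\sum_i ((fun y => lfield v y 0 i) * 'D_(delta_mx 0 i) (phi \o expg)))) => //.
- move=> y Ay; have dphiy := dphi y Ay.
  rewrite /= left_derivE// fct_sumE deriveE// [in RHS](row_sum_delta (lfield v y)).
  by rewrite linear_sum; apply: eq_bigr => i _; rewrite linearZ/= -(deriveE _ dphiy).
- apply: Ck_on_sum => // i; apply: Ck_onM => //; last exact: Dphi.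
  by apply: Ck_on_coord => //; apply: Ck_on_subset (lfield_smooth v j) => y _.
Qed.

Lemma left_deriv_smooth v (phi : G -> R) : smooth (phi \o expg) ->
  smooth (left_deriv expg v phi \o expg).
Proof. by move=> Sphi j; exact: left_deriv_Ck openT (Sphi j.+1). Qed.

Let coordg i (p : G) : R := logg p 0 i.

Let coordgE i : coordg i \o expg = fun y => y 0 i.
Proof. by apply/funext => y; rewrite /= /coordg expgK. Qed.

Let coordg_smooth i : smooth (coordg i \o expg).
Proof.
move=> j; rewrite coordgE; apply: (@Ck_on_coord _ _ _ _ _ id); first exact: openT.
case: j => [x _|j]; first exact: cvg_id.
split=> [x _|v]; first exact: ex_diff.
by rewrite (_ : 'D_v _ = cst v); [exact: Ck_on_cst|apply/funext => x; rewrite derive_id].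
Qed.

Let left_deriv_coordg v i y : left_deriv expg v (coordg i) (expg y) = lfield v y 0 i.
Proof.
rewrite left_derivE; last exact: smooth_differentiable.
by rewrite coordgE (@derive_coord _ _ _ id)// derive_id.
Qed.

Let left_deriv2_coordg u v i y :
  left_deriv expg u (left_deriv expg v (coordg i)) (expg y) =
  'D_(lfield u y) (lfield v) y 0 i.
Proof.
rewrite left_derivE; last exact/smooth_differentiable/left_deriv_smooth.
rewrite (_ : _ \o _ = fun y => lfield v y 0 i) ?derive_coord//.
  exact: lfield_differentiable.
by apply/funext => z; exact: left_deriv_coordg.
Qed.

(** [liebP] describes the bracket by its action on functions; applied to the
    coordinate functions it becomes an identity between vector fields. *)
Lemma lfield_bracket u v y :
  'D_(lfield u y) (lfield v) y - 'D_(lfield v y) (lfield u) y = lfield (lieb u v) y.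
Proof.
apply/rowP => i; rewrite -left_deriv_coordg -liebP//.
by rewrite !left_deriv2_coordg !mxE.
Qed.

(** Bilinearity and antisymmetry of the bracket are read off from this formula,
    the value of [lfield_bracket] at the identity. *)
Lemma liebE u v : lieb u v = 'D_u (lfield v) 0 - 'D_v (lfield u) 0.
Proof. by have := lfield_bracket u v 0; rewrite !lfield0. Qed.

Lemma liebC u v : lieb u v = - lieb v u.
Proof. by rewrite !liebE opprB. Qed.

Lemma lieb_linear u : linear (lieb u).
Proof.
move=> a v w; rewrite !liebE.
have -> : lfield (a *: v + w) = a *: lfield v + lfield w.
  by apply/funext => y; rewrite lfield_linear.
have dv : derivable (lfield v) 0 u.
  by apply: diff_derivable; exact: lfield_differentiable.
have dw : derivable (lfield w) 0 u.
  by apply: diff_derivable; exact: lfield_differentiable.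
rewrite (deriveD (derivableZ (k := a) dv) dw) (deriveZ a dv).
have DE := derive_linear v w a (lfield_differentiable u 0).
apply: (etrans (congr1 (fun z => _ - z) DE)).
by rewrite opprD addrACA scalerBr.
Qed.

Lemma lieb_linearl v : linear (lieb^~ v).
Proof.
by move=> a u w; rewrite liebC lieb_linear opprD -scalerN -!liebC.
Qed.

(** Commutators of operators on functions satisfy the Jacobi identity, and a
    vector is determined by the action at the identity of its left-invariant
    derivation on the coordinate functions. *)
Lemma lieb_jacobi u v w : lieb (lieb u v) w = lieb u (lieb v w) - lieb v (lieb u w).
Proof.
pose L := left_deriv expg.
have LL a b (phi : G -> R) : smooth (phi \o expg) ->
    L (lieb a b) phi = L a (L b phi) - L b (L a phi).
  by move=> Sphi; apply/funext => p; rewrite !fctE /L -liebP.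
have LB a (f g : G -> R) p : smooth (f \o expg) -> smooth (g \o expg) ->
    L a (f - g) p = L a f p - L a g p.
  move=> Sf Sg; rewrite -(loggK p).
  have df := smooth_differentiable (logg p) Sf.
  have dg := smooth_differentiable (logg p) Sg.
  rewrite /L left_derivE; last by rewrite (_ : _ \o _ = (f \o expg) - (g \o expg))//;
    exact: differentiableB.
  rewrite !left_derivE// -deriveB//; exact: diff_derivable.
apply/rowP => i; have Sq := coordg_smooth i.
have S a (f : G -> R) : smooth (f \o expg) -> smooth (L a f \o expg).
  exact: left_deriv_smooth.
have E (a : U) : a 0 i = L a (coordg i) 1%g.
  by rewrite -expg_zero /L left_deriv_coordg lfield0.
have fB (f g : G -> R) p : (f - g) p = f p - g p by [].
pose D a b c := L a (L b (L c (coordg i))) 1%g.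
have T a b c : lieb (lieb a b) c 0 i =
    D a b c - D b a c - (D c a b - D c b a).
  rewrite E (LL _ c _ Sq) fB (LL a b _ Sq).
  rewrite (LL a b _ (S c _ Sq)) (LB c _ _ _ (S a _ (S b _ Sq)) (S b _ (S a _ Sq))).
  by [].
have T' a b c : lieb a (lieb b c) 0 i =
    D a b c - D a c b - (D b c a - D c b a).
  rewrite E (LL a _ _ Sq) fB (LL b c _ Sq).
  rewrite (LL b c _ (S a _ Sq)) (LB a _ _ _ (S b _ (S c _ Sq)) (S c _ (S b _ Sq))).
  by [].
clearbody D; rewrite !mxE T !T'; ring.
Qed.

(** A one-parameter subgroup is an integral curve of its left-invariant field. *)
Lemma lfield_line (t : R) x : lfield x (t *: x) = x.
Proof.
pose L := line_lin x.
rewrite lfield_derive derive_line.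
have -> : (fun h : R => lmul (t *: x) (h *: x + 0)) = (fun h => id (L h + t *: x)).
  by apply/funext => h; rewrite addr0 lmul_line scalerDl addrC.
by rewrite (derive_comp_affine L (t *: x) id)/= derive_id scale1r.
Qed.

(** The coordinates at [x], in the left-invariant frame, of the constant field
    [y]: the left Maurer--Cartan form evaluated on [y]. *)
Definition lcofield (y x : U) : U := 'D_y (lmul (- x)) x.

Let lcofieldE y x :
  lcofield y x = 'D_(0, y) mul2 (pairN x).
Proof.
rewrite /lcofield.
rewrite (_ : lmul (- x) = fun w => mul2 (pairR w + (- x, 0))).
  have E : pairR x + (- x, 0) = pairN x.
    by rewrite /pairR /pairN !mklinearE; congr pair; rewrite /= ?add0r ?addr0.
  by rewrite (derive_comp_affine pairR _ mul2) E.
by apply/funext => w; exact: lmulE.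
Qed.

Lemma lcofield_smooth y : smooth (lcofield y).
Proof.
have -> : lcofield y = fun x => 'D_(0, y) mul2 (pairN x + 0).
  by apply/funext => x; rewrite lcofieldE addr0.
have cL : continuous pairN by exact: linear_rV_continuous.
exact: (smooth_comp_affine 0 cL (smooth_derive (0, y) mul_smooth)).
Qed.

Lemma lcofieldK v x : lcofield (lfield v x) x = v.
Proof.
have dx := smooth_differentiable 0 (lmul_smooth x).
have dN : differentiable (lmul (- x)) (lmul x 0).
  exact: smooth_differentiable (lmul_smooth _).
have := derive_chain v dx dN; rewrite lmulx0 => E.
rewrite /lcofield lfield_derive -E.
by rewrite (_ : _ \o _ = id) ?derive_id//; exact/funext/lmulK.
Qed.

Lemma lfieldK y x : lfield (lcofield y x) x = y.
Proof.
have dN := smooth_differentiable x (lmul_smooth (- x)).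
have dx : differentiable (lmul x) (lmul (- x) x).
  exact: smooth_differentiable (lmul_smooth _).
have := derive_chain y dN dx; rewrite lmulNx => E.
rewrite /lcofield lfield_derive -E.
by rewrite (_ : _ \o _ = id) ?derive_id//; exact/funext/lmulVK.
Qed.

Opaque lcofield.

(** The Maurer--Cartan equation along the ray through [x].  The derivative along
    [x] of the field [lfield z], which enters when [lfield (z s) (s *: x) = y] is
    differentiated, is expressed through the bracket by [lfield_bracket]; the
    term that this introduces, the derivative of [lfield x] along [y], is
    computed by differentiating the identity [lfield w w = w]. *)
Lemma lcofield_ode x y (t : R) :
  is_derive t (1 : R) (fun s : R => s *: lcofield y (s *: x))
    (y - lieb x (t *: lcofield y (t *: x))).
Proof.
pose L := line_lin x.
have cL : continuous L by exact: line_lin_continuous.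
pose z s := lcofield y (s *: x).
have Sz : smooth z.
  rewrite (_ : z = fun s => lcofield y (L s + 0)).
    exact: smooth_comp_affine (lcofield_smooth y).
  by apply/funext => s; rewrite addr0.
have dz := smooth_differentiable t Sz.
have dL : differentiable L t by exact: linear_differentiable.
have DL : 'D_1 L t = x by rewrite deriveE// diff_lin//= scale1r.
pose dzt := 'D_1 z t.
(* Differentiating lfield (z s) (s *: x) = y at s = t. *)
have E1 : lfield dzt (t *: x) + 'D_x (lfield (z t)) (t *: x) = 0.
  have := @derive_linear_family _ _ _ lfield z L t 1 lfield_linear
    lfield_differentiable dz dL.
  rewrite DL => <-; rewrite (_ : (fun b => _) = cst y) ?derive_cst//.
  by apply/funext => s; exact: lfieldK.
(* Differentiating lfield w w = w at w = t *: x in the direction y. *)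
have E2 : lfield y (t *: x) + t *: 'D_y (lfield x) (t *: x) = y.
  have did : differentiable (id : U -> U) (t *: x) by exact: ex_diff.
  have := @derive_linear_family _ _ _ lfield id id (t *: x) y lfield_linear
    lfield_differentiable did did.
  rewrite derive_id (_ : (fun b => _) = id) ?derive_id; last first.
    by apply/funext => w; rewrite -[X in lfield _ X]scale1r lfield_line.
  have -> : lfield (t *: x) = t *: lfield x.
    apply/funext => w; pose N := mklinear (lfield_linear w).
    by rewrite -[LHS]/(N _) linearZ.
  have dxy : derivable (lfield x) (t *: x) y.
    by apply: diff_derivable; exact: lfield_differentiable.
  by rewrite (deriveZ t dxy).
have E3 := lfield_bracket x (z t) (t *: x).
rewrite lfield_line [lfield (z t) _]lfieldK in E3.
have dzt_eq : t *: dzt = y - z t - t *: lieb x (z t).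
  pose N := mklinear (lfield_linear (t *: x)).
  apply: (can_inj (lcofieldK^~ (t *: x))).
  rewrite -[LHS]/(N _) -[RHS]/(N _) !linearB !linearZ /=.
  have Nz : lfield (z t) (t *: x) = y by exact: lfieldK.
  move/eqP: E1; rewrite addr_eq0 => /eqP ->; rewrite Nz -E3.
  rewrite !scalerN scalerBr opprB addrA.
  have -> : lfield y (t *: x) - y + t *: 'D_y (lfield x) (t *: x) = 0.
    by rewrite addrAC E2 subrr.
  by rewrite sub0r.
apply: is_derive_eq (is_derive_scale_line dz) _.
have adZ : lieb x (t *: z t) = t *: lieb x (z t).
  by have := linearZ_LR (mklinear (lieb_linear x)) t (z t).
by rewrite adZ dzt_eq addrA [z t + _]addrC subrK.
Qed.

(** The image by [A] of the solution of [lcofield_ode] attached to [(x, y)] solves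
    the equation attached to [(A x, A y)], since only the bracket enters it; by
    uniqueness it is the solution attached to [(A x, A y)].  At time 1 this says
    that [A] commutes with [lcofield], hence with its inverse [lfield]. *)
Lemma lfield_lie_hom (A : {linear U -> U}) :
  (forall u v, A (lieb u v) = lieb (A u) (A v)) ->
  forall v x, lfield (A v) (A x) = A (lfield v x).
Proof.
move=> Ahom v x; set y := lfield v x.
have cA : continuous A by exact: linear_rV_continuous.
pose Z x y (s : R) := s *: lcofield y (s *: x).
pose B := mklinear (lieb_linear (A x)).
pose B' := mklinear (lieb_linearl (A x)).
suff ZA : Z (A x) (A y) 1 = A (Z x y 1).
  move: ZA; rewrite /Z !scale1r /y lcofieldK => /(congr1 (lfield^~ (A x))).
  by rewrite lfieldK => <-.
apply/eqP; rewrite -subr_eq0; apply/eqP.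
pose w := Z (A x) (A y) - (A \o Z x y).
apply: (@linear_ode_unique _ _ B' w); last first.
  by rewrite /w !fctE /= /Z !scale0r linear0 subrr.
move=> t; have D1 := lcofield_ode (A x) (A y) t.
have D2 := lcofield_ode x y t.
have dZ : differentiable (Z x y) t by apply/derivable1_diffP; case: D2.
have D2' : is_derive t (1 : R) (A \o Z x y) (A (y - lieb x (Z x y t))).
  apply: DeriveDef.
    apply/derivable1_diffP/differentiable_comp => //.
    exact: linear_differentiable.
  rewrite derive_chain//; last exact: linear_differentiable.
  rewrite deriveE; last exact: linear_differentiable.
  by rewrite diff_lin//; case: D2 => _ ->.
apply: (is_derive_eq (is_deriveB D1 D2')).
rewrite linearB Ahom /w mklinearE fctE (liebC (_ - _)) [RHS]/=.
have BB a b : lieb (A x) (a - b) = lieb (A x) a - lieb (A x) b := linearB B a b.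
rewrite BB -/(Z (A x) (A y) t) opprD addrACA subrr add0r opprK.
by rewrite opprB addrC.
Qed.

End LieGroup.

(** * Dilations are Lie algebra endomorphisms *)

Lemma span_ind (K : fieldType) (vT : vectType K) (P : vT -> Prop) (X : seq vT) :
  P 0 -> (forall a u v, P u -> P v -> P (a *: u + v)) ->
  {in X, forall x, P x} -> {in <<X>>%VS, forall u, P u}.
Proof.
move=> P0 PD PX u /(@coord_span _ _ _ (in_tuple X)) ->.
elim/big_ind : _ => // [v w Pv Pw|i _]; first by rewrite -[v]scale1r; exact: PD.
by rewrite -[_ *: _]addr0; apply: PD => //; apply: PX; exact: mem_nth.
Qed.

Section Dilation.
Context {R : realType} {n k : nat} (G : carnotGroup R n k).
Local Notation U := ('rV[R]_n).
Local Notation lieb := (lieb G).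
Local Notation layer := (layer G).
Local Notation alg_dil := (alg_dil G).

Let proj j : U -> U := sumv_pi (\sum_(i < k) layer i.+1)%VS j.

Let proj_layer j u : proj j u \in layer j.+1.
Proof. exact: memv_sum_pi. Qed.

Let proj_sum u : \sum_(j < k) proj j u = u.
Proof. by apply: sumv_pi_sum; rewrite layer_full memvf. Qed.

Let proj_uniq (w : 'I_k -> U) j :
  (forall i, w i \in layer i.+1) -> proj j (\sum_i w i) = w j.
Proof.
move=> wl; have := layer_direct G => /directv_sum_unique.
move=> /(_ (fun i => proj i (\sum_i w i)) w).
by rewrite proj_sum eqxx => /(_ (fun i _ => proj_layer _ _) (fun i _ => wl i))/esym
  /'forall_eqP -> .
Qed.

Lemma alg_dil_sum l (w : 'I_k -> U) : (forall i, w i \in layer i.+1) ->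
  alg_dil l (\sum_(i < k) w i) = \sum_(i < k) l ^+ i.+1 *: w i.
Proof. by move=> wl; apply: eq_bigr => i _; rewrite -/(proj _ _) proj_uniq. Qed.

Lemma alg_dil_layer l (j : 'I_k) v : v \in layer j.+1 -> alg_dil l v = l ^+ j.+1 *: v.
Proof.
move=> vl; pose w i := if i == j then v else 0.
have wl i : w i \in layer i.+1 by rewrite /w; case: eqP => [->|_]; rewrite ?mem0v.
have wv : \sum_i w i = v.
  by rewrite (bigD1 j)//= /w eqxx big1 ?addr0// => i /negbTE ->.
rewrite -{1}wv alg_dil_sum// (bigD1 j)//= {1}/w eqxx big1 ?addr0// => i /negbTE ij.
by rewrite /w ij scaler0.
Qed.

Lemma alg_dil_comp l m u : alg_dil l (alg_dil m u) = alg_dil (l * m) u.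
Proof.
rewrite [alg_dil m u]/Defs.alg_dil alg_dil_sum => [|i].
  by apply: eq_bigr => i _; rewrite scalerA exprMn.
by apply: memvZ; exact: proj_layer.
Qed.

Lemma alg_dil1 u : alg_dil 1 u = u.
Proof.
by rewrite -[RHS]proj_sum; apply: eq_bigr => i _; rewrite expr1n scale1r.
Qed.

Lemma alg_dil0 u : alg_dil 0 u = 0.
Proof. by rewrite /alg_dil big1// => i _; rewrite expr0n scale0r. Qed.

Lemma alg_dil_linear l : linear (alg_dil l).
Proof.
move=> a u v; rewrite /alg_dil scaler_sumr -big_split/=; apply: eq_bigr => i _.
by rewrite linearP scalerDr !scalerA mulrC.
Qed.

Lemma continuous_alg_dil u : continuous (fun l => alg_dil l u).
Proof.
have -> : (fun l => alg_dil l u) =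
    \sum_(j < k) (fun l : R => l ^+ j.+1 *: proj j u).
  by apply/funext => l; rewrite fct_sumE.
move=> l; apply: differentiable_continuous; apply: differentiable_sum => j.
by apply: differentiableZl; apply/derivable1_diffP; exact: exprn_derivable.
Qed.

Lemma mem_liebv (V W : {vspace U}) u v : u \in V -> v \in W -> lieb u v \in liebv G V W.
Proof.
move=> uV vW; rewrite (coord_vbasis uV) (coord_vbasis vW).
pose Lr x := mklinear (lieb_linear G x); pose Ll x := mklinear (lieb_linearl G x).
rewrite -[lieb _ _]/(Ll _ _) linear_sum; apply: memv_suml => i _.
rewrite linearZ; apply: memvZ; rewrite -[Ll _ _]/(Lr _ _) linear_sum.
apply: memv_suml => j _; rewrite linearZ; apply: memvZ.
by apply: memv_span; apply: allpairs_f; exact: memt_nth.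
Qed.

(** For [u] in the first layer this is the homogeneity of the inclusion of
    [[g_1, g_j]] into [g_(j+1)].  By the Jacobi identity, the vectors [u] that
    satisfy the identity for all [v] are stable under the bracket, and the first
    layer generates the Lie algebra. *)
Lemma alg_dil_lieb l u v : alg_dil l (lieb u v) = lieb (alg_dil l u) (alg_dil l v).
Proof.
pose A := mklinear (alg_dil_linear l).
pose Lr x := mklinear (lieb_linear G x); pose Ll x := mklinear (lieb_linearl G x).
pose P u := forall v, alg_dil l (lieb u v) = lieb (alg_dil l u) (alg_dil l v).
have A0 : alg_dil l 0 = 0 := linear0 A.
have AD x y : alg_dil l (x + y) = alg_dil l x + alg_dil l y := linearD A x y.
have AB x y : alg_dil l (x - y) = alg_dil l x - alg_dil l y := linearB A x y.
have l0 w : lieb 0 w = 0 := linear0 (Ll w).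
have r0 x : lieb x 0 = 0 := linear0 (Lr x).
have rD x y z : lieb x (y + z) = lieb x y + lieb x z := linearD (Lr x) y z.
have PD a x y : P x -> P y -> P (a *: x + y).
  move=> Px Py w; rewrite (lieb_linearl G w a x y) !alg_dil_linear Px Py.
  by rewrite (lieb_linearl G _ a).
have P0 : P 0 by move=> w; rewrite A0 !l0 A0.
have P1 x : (0 < k)%N -> x \in layer 1 -> P x.
  move=> k0 xl.
  have Ax : alg_dil l x = l *: x by apply: (@alg_dil_layer l (Ordinal k0)).
  have Pj (j : 'I_k) w : w \in layer j.+1 ->
      alg_dil l (lieb x w) = lieb (alg_dil l x) (alg_dil l w).
    move=> wl; rewrite Ax (alg_dil_layer l wl).
    rewrite -[RHS]/(Ll _ (l *: x)) linearZ/= -[lieb x (_ *: _)]/(Lr x _) linearZ/=.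
    rewrite scalerA -exprS.
    have xw := mem_liebv xl wl; have [jk|] := ltnP j.+1 k.
      by rewrite layer_lieb ?jk// in xw; exact: (@alg_dil_layer l (Ordinal jk)).
    rewrite leq_eqVlt ltnNge ltn_ord orbF => /eqP kj.
    move: xw; rewrite -kj layer_lieb_last memv0 => /eqP ->.
    by rewrite scaler0.
  move=> w; rewrite -[w]proj_sum.
  elim/big_ind : _ => [|y z Ey Ez|j _]; last exact: Pj (proj_layer _ _).
    by rewrite A0 !r0.
  by rewrite rD !AD rD Ey Ez.
have Plieb x y : P x -> P y -> P (lieb x y).
  move=> Px Py w; rewrite lieb_jacobi.
  rewrite AB !(Px, Py).
  by rewrite lieb_jacobi.
have PL j : (j < k)%N -> {in layer j.+1, forall x, P x}.
  elim: j => [k0 x|j IH jk]; first exact: P1.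
  rewrite -layer_lieb//; apply: span_ind => // _ /allpairsP[[x y]/= [xl yl ->]].
  apply: Plieb; first by apply: P1 (vbasis_mem xl); exact: leq_ltn_trans jk.
  by apply: IH; [exact: ltnW|exact: vbasis_mem].
suff : P u by exact.
rewrite -[u]proj_sum; elim/big_ind : _ => // [x y Px Py|j _].
  by rewrite -[x]scale1r; exact: PD.
by apply: PL (proj_layer _ _); exact: ltn_ord.
Qed.

End Dilation.

(** * Horizontal derivatives and dilations *)

Opaque derive.

Section GroupTopology.
Context {R : realType} {n : nat} (G : expLieGroup R n).
Local Notation expg := (expg G).
Local Notation logg := (logg G).
Local Notation lmul := (lmul G).
Local Notation lfield := (lfield G).

Lemma expg_comp_mul g : expg \o lmul (logg g) = (fun p => g * p)%g \o expg.
Proof. by apply/funext => y; rewrite /= expg_lmul loggK. Qed.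

Lemma left_mul_continuous (g : G) : continuous (fun p : G => g * p)%g.
Proof.
have -> : (fun p : G => g * p)%g = expg \o (lmul (logg g) \o logg).
  by apply/funext => p; rewrite /= expg_lmul !loggK.
move=> p; apply: continuous_comp; last exact: expg_continuous.
apply: continuous_comp; first exact: logg_continuous.
exact/differentiable_continuous/smooth_differentiable/lmul_smooth.
Qed.

Lemma near_eq_left_deriv v (phi psi : G -> R) p :
  (\forall q \near p, phi q = psi q) ->
  left_deriv expg v phi p = left_deriv expg v psi p.
Proof.
move=> phipsi; apply: near_eq_derive.
have cp : (p * expg w)%g @[w --> (0 : 'rV[R]_n)] --> p.
  have := @left_mul_continuous p (expg 0).
  rewrite /continuous_at expg_zero mulg1 => pc.
  apply: cvg_comp pc; rewrite -(expg_zero G); exact: expg_continuous.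
exact: (cp _ phipsi).
Qed.

Lemma left_deriv_mul v (phi : G -> R) g p :
  left_deriv expg v (fun q => phi (g * q)%g) p = left_deriv expg v phi (g * p)%g.
Proof. by rewrite /left_deriv; congr ('D_v _ 0); apply/funext => w; rewrite mulgA. Qed.

Lemma Ck_on_left_mul j (g : G) (A : set 'rV[R]_n) (phi : G -> R) : open A ->
  Ck_on j A (phi \o expg) ->
  Ck_on j [set y | A (lmul (logg g) y)] ((fun p => phi (g * p)%g) \o expg).
Proof.
move=> oA Cphi; have S := lmul_smooth G (logg g).
have oB : open [set y | A (lmul (logg g) y)].
  apply: open_comp oA => y _.
  exact/differentiable_continuous/smooth_differentiable.
rewrite (_ : _ \o expg = (phi \o expg) \o lmul (logg g)).
  by apply: Ck_on_comp Cphi => //; exact: Ck_on_subset (S j).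
by rewrite -compA expg_comp_mul.
Qed.

End GroupTopology.

Section HorizontalDerivatives.
Context {R : realType} {n k : nat} (G : carnotGroup R n k).
Local Notation expg := (expg G).
Local Notation logg := (logg G).
Local Notation lmul := (lmul G).
Local Notation lfield := (lfield G).
Local Notation dil := (@dil R n k G).
Local Notation dil_at := (@dil_at R n k G).

Lemma dil_comp l m p : dil l (dil m p) = dil (l * m) p.
Proof. by rewrite /Defs.dil expgK alg_dil_comp. Qed.

Lemma dil1 p : dil 1 p = p.
Proof. by rewrite /Defs.dil alg_dil1 loggK. Qed.

Lemma dil0 p : dil 0 p = 1%g.
Proof. by rewrite /Defs.dil alg_dil0 expg_zero. Qed.

Lemma alg_dil_continuous l : continuous (alg_dil G l).
Proof.
have : continuous (mklinear (alg_dil_linear G l)) by exact: linear_rV_continuous.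
by [].
Qed.

Lemma dil_continuous l : continuous (dil l).
Proof.
move=> p; apply: (@continuous_comp _ _ _ (alg_dil G l \o logg)).
  apply: continuous_comp; first exact: logg_continuous.
  exact: alg_dil_continuous.
exact: expg_continuous.
Qed.

Lemma dil_continuous_param p : continuous (fun l => dil l p).
Proof.
move=> l; apply: (@continuous_comp _ _ _ (fun l => alg_dil G l (logg p))).
  exact: continuous_alg_dil.
exact: expg_continuous.
Qed.

Lemma dil_at_comp p0 l m p : dil_at p0 l (dil_at p0 m p) = dil_at p0 (l * m) p.
Proof. by rewrite /Defs.dil_at mulKg dil_comp. Qed.

Lemma dil_at1 p0 p : dil_at p0 1 p = p.
Proof. by rewrite /Defs.dil_at dil1 mulVKg. Qed.

Lemma dil_at_continuous p0 l : continuous (dil_at p0 l).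
Proof.
move=> p; apply: (@continuous_comp _ _ _ (dil l \o (fun p => p0^-1 * p)%g)).
  apply: continuous_comp; first exact: left_mul_continuous.
  exact: dil_continuous.
exact: left_mul_continuous.
Qed.

Lemma dil_at_differentiable p0 l y : differentiable (logg \o dil_at p0 l \o expg) y.
Proof.
pose A := mklinear (alg_dil_linear G l).
have cA : continuous A by exact: linear_rV_continuous.
rewrite (_ : _ \o expg = lmul (logg p0) \o (A \o lmul (logg p0^-1%g))).
  apply: differentiable_comp; last exact/smooth_differentiable/lmul_smooth.
  apply: differentiable_comp; first exact/smooth_differentiable/lmul_smooth.
  exact: linear_differentiable.
by apply/funext => z; rewrite /= /lmul !loggK.
Qed.

(** The differential of the dilation maps the left-invariant field of [v] to that
    of [l *: v]. *)
Lemma left_deriv_dil v (phi : G -> R) l p : v \in layer G 1 -> (0 < k)%N ->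
  differentiable (phi \o expg) (logg (dil l p)) ->
  left_deriv expg v (phi \o dil l) p = l * left_deriv expg v phi (dil l p).
Proof.
move=> vl k0; pose A := mklinear (alg_dil_linear G l); pose x := logg p.
have cA : continuous A by exact: linear_rV_continuous.
have -> : dil l p = expg (A x) by [].
rewrite expgK => dphi; rewrite -{1}(loggK p) -/x.
have dA : differentiable A x.
  by apply: linear_differentiable; exact: linear_rV_continuous.
have E : (phi \o dil l) \o expg = (phi \o expg) \o A.
  by apply/funext => y; rewrite /= /Defs.dil expgK.
have dphiA : differentiable ((phi \o expg) \o A) x.
  exact: differentiable_comp.
rewrite left_derivE E// (derive_chain _ dA dphi) left_derivE//.
have -> : 'D_(lfield v x) A x = l *: lfield v (A x).
  rewrite deriveE// diff_lin//=.
  rewrite -[LHS]/(A (lfield v x)) -(lfield_lie_hom (A := A) (alg_dil_lieb _ l)).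
  have -> : A v = l *: v by exact: (@alg_dil_layer _ _ _ G l (Ordinal k0)).
  have LZ := linearZ_LR (mklinear (lfield_linear G (A x))).
  exact: LZ.
rewrite !deriveE//; exact: (linearZ_LR ('d (phi \o expg) (A x))).
Qed.

Lemma left_deriv_dil_at v (phi : G -> R) p0 l p : v \in layer G 1 -> (0 < k)%N ->
  differentiable (phi \o expg) (logg (dil_at p0 l p)) ->
  left_deriv expg v (phi \o dil_at p0 l) p =
  l * left_deriv expg v phi (dil_at p0 l p).
Proof.
move=> vl k0 dphi; pose psi q := phi (p0 * q)%g.
have dpsi : differentiable (psi \o expg) (logg (dil l (p0^-1 * p)%g)).
  rewrite (_ : psi \o expg = (phi \o expg) \o lmul (logg p0)).
    apply: differentiable_comp.
      exact/smooth_differentiable/lmul_smooth.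
    by rewrite /lmul !loggK.
  by rewrite -compA expg_comp_mul.
rewrite -[RHS]/(l * left_deriv expg v phi (p0 * dil l (p0^-1 * p))%g).
rewrite -left_deriv_mul -/psi -left_deriv_dil//.
by rewrite -(left_deriv_mul v (psi \o dil l)).
Qed.

Lemma hgradE m (e : m.-tuple 'rV[R]_n) (phi : G -> R) p i :
  hgrad e phi p i 0 = hfield e i phi p.
Proof. by rewrite mxE. Qed.

Lemma hhessE m (e : m.-tuple 'rV[R]_n) (phi : G -> R) p i j :
  hhess e phi p i j =
  2^-1 * (hfield e i (hfield e j phi) p + hfield e j (hfield e i phi) p).
Proof. by rewrite mxE. Qed.

Lemma hfieldE m (e : m.-tuple 'rV[R]_n) (phi : G -> R) i :
  hfield e i phi = left_deriv expg (tnth e i) phi.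
Proof. by []. Qed.

Lemma near_eq_hfield m (e : m.-tuple 'rV[R]_n) i (phi psi : G -> R) p :
  (\forall q \near p, phi q = psi q) -> hfield e i phi p = hfield e i psi p.
Proof. exact: near_eq_left_deriv. Qed.

Opaque hgrad hhess hfield.

Section SecondOrder.
Variables (m : nat) (e : m.-tuple 'rV[R]_n) (p0 : G) (l : R) (O : set G).
Variable phi : G -> R.
Hypotheses (k0 : (0 < k)%N) (oO : open O) (phi2 : C2_on O phi).
Hypothesis he : forall i, tnth e i \in layer G 1.

Let oB : open (expg @^-1` O).
Proof. by apply: open_comp oO => x _; exact: expg_continuous. Qed.

Let d1 p : O p -> differentiable (phi \o expg) (logg p).
Proof. by move=> Op; apply: phi2.1; rewrite /= loggK. Qed.

Lemma hfield_dil_at i p : O (dil_at p0 l p) ->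
  hfield e i (phi \o dil_at p0 l) p = l * hfield e i phi (dil_at p0 l p).
Proof. by move=> Op; apply: left_deriv_dil_at => //; exact: d1. Qed.

Lemma hfield2_dil_at i j p : O (dil_at p0 l p) ->
  hfield e i (hfield e j (phi \o dil_at p0 l)) p =
  l ^+ 2 * hfield e i (hfield e j phi) (dil_at p0 l p).
Proof.
move=> Op.
rewrite !hfieldE (@near_eq_left_deriv _ _ _ _ _
  (fun q => l * (left_deriv expg (tnth e j) phi \o dil_at p0 l) q)); last first.
  have : nbhs p (dil_at p0 l @^-1` O).
    by apply: dil_at_continuous; move: oO; rewrite openE; exact.
  by apply: filterS => q Oq; exact: hfield_dil_at.
have d2 : differentiable (left_deriv expg (tnth e j) phi \o expg)
    (logg (dil_at p0 l p)).
  have [d2 _] := left_deriv_Ck (j := 1) (tnth e j) oB phi2.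
  by apply: d2; rewrite /= loggK.
have LZ (f : G -> R) : differentiable (f \o expg) (logg p) ->
    left_deriv expg (tnth e i) (fun q => l * f q) p =
    l * left_deriv expg (tnth e i) f p.
  move=> df; rewrite -(loggK p) left_derivE; last exact: (differentiableZ l df).
  rewrite (left_derivE _ df).
  have dv : derivable (f \o expg) (logg p) (lfield (tnth e i) (logg p)).
    exact: diff_derivable.
  exact: (deriveZ l dv).
rewrite LZ; last first.
  rewrite (_ : _ \o expg = (left_deriv expg (tnth e j) phi \o expg) \o
    (logg \o dil_at p0 l \o expg)); last first.
    by apply/funext => y; rewrite /= loggK.
  apply: differentiable_comp; first exact: dil_at_differentiable.
  by rewrite /= loggK.
by rewrite left_deriv_dil_at// mulrA.
Qed.

Lemma hgrad_dil_at p : O (dil_at p0 l p) ->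
  hgrad e (phi \o dil_at p0 l) p = l *: hgrad e phi (dil_at p0 l p).
Proof. by move=> Op; apply/colP => i; rewrite [RHS]mxE !hgradE hfield_dil_at. Qed.

Lemma hhess_dil_at p : O (dil_at p0 l p) ->
  hhess e (phi \o dil_at p0 l) p = l ^+ 2 *: hhess e phi (dil_at p0 l p).
Proof.
move=> Op; apply/matrixP => i j; rewrite [RHS]mxE.
apply: etrans (hhessE _ _ _ i j) _; have -> := hhessE e phi (dil_at p0 l p) i j.
have H1 := hfield2_dil_at i j Op; have H2 := hfield2_dil_at j i Op.
apply: etrans (congr2 (fun s t => 2^-1 * (s + t)) H1 H2) _.
by rewrite -mulrDr; exact: mulrCA.
Qed.

End SecondOrder.

Lemma near_eq_hgrad m (e : m.-tuple 'rV[R]_n) (phi psi : G -> R) p :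
  (\forall q \near p, phi q = psi q) -> hgrad e phi p = hgrad e psi p.
Proof. by move=> E; apply/colP => i; rewrite !hgradE; exact: near_eq_hfield. Qed.

Lemma near_eq_hhess m (e : m.-tuple 'rV[R]_n) (phi psi : G -> R) p :
  (\forall q \near p, phi q = psi q) -> hhess e phi p = hhess e psi p.
Proof.
move=> E; apply/matrixP => i j.
apply: etrans (hhessE _ _ _ i j) _; apply: etrans _ (esym (hhessE _ _ _ i j)).
have E1 a : \forall q \near p, hfield e a phi q = hfield e a psi q.
  by have := near_join E; apply: filterS => q; exact: near_eq_hfield.
have H a b : hfield e a (hfield e b phi) p = hfield e a (hfield e b psi) p.
  exact: near_eq_hfield (E1 b).
exact: (congr2 (fun s t => 2^-1 * (s + t)) (H i j) (H j i)).
Qed.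

Lemma hhess_sym m (e : m.-tuple 'rV[R]_n) (phi : G -> R) p : symmx (hhess e phi p).
Proof.
apply/matrixP => i j; apply: etrans (_ : hhess e phi p j i = _); first by rewrite mxE.
apply: etrans (hhessE _ _ _ j i) _; apply: etrans _ (esym (hhessE _ _ _ i j)).
exact: (congr1 (GRing.mul 2^-1) (addrC _ _)).
Qed.

(** [phi \o dil_at p0 l] is of class C^2 only where the dilation lands in [O];
    localising it near [p] makes it a test function on any open set. *)
Lemma C2_pullback p0 l (O : set G) (phi : G -> R) p :
  open O -> C2_on O phi -> O (dil_at p0 l p) ->
  exists2 psi : G -> R, C2_on setT psi &
    \forall q \near p, psi q = phi (dil_at p0 l q).
Proof.
move=> oO phi2 Op.
have oB : open (expg @^-1` O).
  by apply: open_comp oO => x _; exact: expg_continuous.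
have C1 := Ck_on_left_mul p0 oB phi2.
set B1 := [set y | _] in C1.
have oB1 : open B1.
  apply: open_comp oB => y _.
  exact/differentiable_continuous/smooth_differentiable/lmul_smooth.
pose A := mklinear (alg_dil_linear G l).
have cA : continuous A by exact: linear_rV_continuous.
have C2 := Ck_on_comp_affine 0 cA oB1 C1.
set B2 := [set y | _] in C2.
have oB2 : open B2.
  apply: open_comp oB1 => y _; apply: continuousD; first exact: cA.
  exact: cst_continuous.
pose phi' := (fun p : G => phi (p0 * dil l p)%g).
have E2 : phi' \o expg = (fun y => ((fun p => phi (p0 * p)%g) \o expg) (A y + 0)).
  by apply/funext => y; rewrite /phi' /= addr0 /Defs.dil expgK.
rewrite -E2 in C2.
have C3 := Ck_on_left_mul p0^-1%g oB2 C2.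
set B3 := [set y | _] in C3.
have oB3 : open B3.
  apply: open_comp oB2 => y _.
  exact/differentiable_continuous/smooth_differentiable/lmul_smooth.
have B3p : B3 (logg p).
  rewrite /B3/= /B2/= /B1/= addr0 /lmul !loggK.
  exact: Op.
have [g Cg gE] := C2_localization oB3 B3p C3.
exists (g \o logg).
  rewrite /C2_on (_ : _ \o expg = g); first by apply: Ck_on_subset Cg.
  by apply/funext => y; rewrite /= expgK.
have : \forall q \near p, g (logg q) = (phi' \o (fun q => p0^-1 * q)%g \o expg) (logg q).
  exact: logg_continuous gE.
apply: filterS => q /= ->.
by rewrite /phi' loggK.
Qed.

End HorizontalDerivatives.

(** * Starshaped sets *)

Section Starshaped.
Context {R : realType} {n k : nat} (G : carnotGroup R n k) (p0 : G).

Lemma starshaped_at_dil (A : set G) (l : R) p :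
  starshaped_at p0 A -> 0 <= l <= 1 -> A p -> A (dil_at p0 l p).
Proof.
move=> [_ [_ _ EA]] l01 Ap.
have : (\bigcup_(l in [set l : R | 0 <= l <= 1])
    (dil l @` ((fun p : G => p0^-1 * p)%g @` A))) (dil l (p0^-1 * p)%g).
  exists l => //; exists (p0^-1 * p)%g => //; by exists p.
by rewrite -EA => -[q Aq qE]; rewrite /Defs.dil_at -qE mulVKg.
Qed.

Lemma closure_dil_at (A : set G) (l : R) p :
  (forall q, A q -> A (dil_at p0 l q)) ->
  closure A p -> closure A (dil_at p0 l p).
Proof.
move=> Al clAp B nB.
have [q [Aq Bq]] := clAp _ (dil_at_continuous nB).
by exists (dil_at p0 l q); split => //; exact: Al.
Qed.

(** The dilates of a point trace a path to the centre, so stability under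
   contractions implies connectedness. *)
Lemma starshaped_atP (A : set G) : A p0 ->
  (forall (l : R) p, 0 <= l <= 1 -> A p -> A (dil_at p0 l p)) ->
  starshaped_at p0 A.
Proof.
move=> Ap0 Al; split => //; set A' := (_ @` A).
have A'1 : A' 1%g by exists p0; rewrite ?mulVg.
have A'l (l : R) p : 0 <= l <= 1 -> A' p -> A' (dil l p).
  move=> l01 [q Aq <-]; exists (dil_at p0 l q); first exact: Al.
  by rewrite /Defs.dil_at mulKg.
have I1 : 0 <= (1 : R) <= 1 by apply/andP; split; rewrite ?ler01.
have I0 : 0 <= (0 : R) <= 1 by apply/andP; split; rewrite ?ler01.
pose I := [set l : R | 0 <= l <= 1].
have path (p : G) : connected ((fun l : R => dil l p) @` I).
  apply: connected_continuous_connected.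
    rewrite (_ : I = `[0, 1]%classic); first exact: segment_connected.
    by apply/seteqP; split => l /=; rewrite in_itv.
  exact/continuous_subspaceT/dil_continuous_param.
split => //; last first.
  apply/seteqP; split => [p A'p|_ [l l01] [p A'p <-]]; last exact: A'l.
  by exists 1 => //; exists p => //; exact: dil1.
rewrite (_ : A' = \bigcup_(p in A') ((fun l : R => dil l p) @` [set l | 0 <= l <= 1])).
  apply: bigcup_connected => [|p _]; last exact: path.
  by exists 1%g => p _; exists 0 => //; exact: dil0.
apply/seteqP; split => [p A'p|_ [p A'p] [l l01 <-]]; last exact: A'l.
by exists p => //; exists 1 => //; exact: dil1.
Qed.

End Starshaped.

(** * The dilated function is a subsolution *)

Section Subsolution.
Context {R : realType} {n k m : nat} (G : carnotGroup R n k).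
Context (e : m.-tuple 'rV[R]_n) (F : G -> R -> 'cV[R]_m -> 'M[R]_m -> R).

(** The test function [phi], moved to [dil_at p0 l p], touches [f] there.  Its
    horizontal derivatives of order one and two have been multiplied by [l^-1]
    and [l^-2], which the scaling hypothesis compensates. *)
Lemma dilated_subsolution (p0 : G) (O : set G) (f phi : G -> R) (l : R) p :
  (0 < k)%N -> (forall i, tnth e i \in layer G 1) -> open O ->
  (forall p r xi M l, symmx M -> 1 <= l -> O p -> O (dil_at p0 l^-1 p) ->
     0 <= F p r xi M ->
     0 <= F (dil_at p0 l^-1 p) r (l *: xi) (l ^+ 2 *: M)) ->
  viscosity_subsolution e F O f -> 1 <= l ->
  O p -> O (dil_at p0 l p) -> C2_on O phi ->
  touches_above phi (f \o dil_at p0 l) p ->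
  0 <= F p (f (dil_at p0 l p)) (hgrad e phi p) (hhess e phi p).
Proof.
move=> k0 he oO scaling [_ fsub] l1 Op OP phi2 [phip phi_ge].
have l0 : l != 0 by rewrite gt_eqF// (lt_le_trans ltr01).
set P := dil_at p0 l p in OP phip *.
have Pp : dil_at p0 l^-1 P = p by rewrite dil_at_comp mulVf// dil_at1.
have OPp : O (dil_at p0 l^-1 P) by rewrite Pp.
have [psi psi2 psiE] := C2_pullback oO phi2 OPp.
have psi_touch : touches_above psi f P.
  split; first by rewrite (nbhs_singleton psiE) Pp phip.
  have : nbhs P (dil_at p0 l^-1 @^-1` [set q | f (dil_at p0 l q) <= phi q]).
    by apply: dil_at_continuous; rewrite Pp.
  apply: filterS2 psiE => q -> /=.
  by rewrite dil_at_comp mulfV// dil_at1.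
have psi2O : C2_on O psi by apply: Ck_on_subset psi2 => q _.
have := fsub P OP psi psi2O psi_touch.
rewrite (near_eq_hgrad e psiE) (near_eq_hhess e psiE).
rewrite (hgrad_dil_at k0 phi2 he OPp) (hhess_dil_at k0 oO phi2 he OPp) => FP.
have hs : symmx (l^-1 ^+ 2 *: hhess e phi p).
  by rewrite /symmx linearZ/= (hhess_sym e phi p).
rewrite Pp in FP; have := scaling P _ _ _ l hs l1 OP OPp FP.
rewrite Pp !scalerA mulfV// scale1r -exprMn mulfV// expr1n scale1r.
by [].
Qed.

End Subsolution.

(** * Starshapedness of the superlevel sets *)
Theorem theorem1p1 (R : realType) (n k m : nat) (hk : (2 <= k)%N)
    (G : carnotGroup R n k)
    (ip : {dot 'rV[R]_n for idfun}) (e : m.-tuple 'rV[R]_n)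
    (he : horizontal_basis G ip e)
    (O0 O1 : set G) (hO : condenser O0 O1)
    (p0 : G) (hp0 : O1 p0)
    (hstar0 : starshaped_at p0 O0) (hstar1 : starshaped_at p0 O1)
    (F : G -> R -> 'cV[R]_m -> 'M[R]_m -> R) :
  let O := O0 `\` closure O1 in
  forall
    (proper : forall p xi M, O p -> symmx M ->
       forall r s, s <= r -> F p r xi M <= F p s xi M)
    (elliptic : forall p r xi, O p ->
       forall M N, symmx M -> symmx N -> lesymmx M N ->
       F p r xi M <= F p r xi N)
    (scaling : forall p r xi M l, symmx M -> 1 <= l ->
       O p -> O (dil_at p0 l^-1 p) ->
       0 <= F p r xi M ->
       0 <= F (dil_at p0 l^-1 p) r (l *: xi) (l ^+ 2 *: M))
    (comparison : forall u v : G -> R,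
       {within closure O, continuous u} -> {within closure O, continuous v} ->
       viscosity_subsolution e F O u -> viscosity_supersolution e F O v ->
       (forall p, boundary O p -> u p <= v p) ->
       forall p, closure O p -> u p <= v p)
    (f : G -> R)
    (f_cont : {within closure O, continuous f})
    (f_sol : viscosity_solution e F O f)
    (f_range : forall p, O p -> 0 <= f p <= 1)
    (f_outer : forall p, boundary O0 p -> f p = 0)
    (f_inner : forall p, closure O1 p -> f p = 1)
    (l : R) (hl : 0 < l < 1),
  starshaped_at p0 [set p | closure O0 p /\ l <= f p].
Proof.
move=> O proper elliptic scaling comparison f f_cont f_sol f_range f_outer f_inner l hl.
have k0 : (0 < k)%N by apply: leq_trans hk.
have [[_ _ oO0] [_ _ oO1] cO10] := hO.
have he1 i : tnth e i \in layer G 1.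
  case: he => eb _; exact: (basis_mem eb (mem_tnth i e)).
have oO : open O by apply: openI => //; exact/closed_openC/closed_closure.
have nO0 p : O0 p -> nbhs p O0 by move: oO0; rewrite openE; exact.
have nO p : O p -> nbhs p O by move: oO; rewrite openE; exact.
have star0 (s : R) p : 0 <= s <= 1 -> O0 p -> O0 (dil_at p0 s p).
  by move=> s01; exact: starshaped_at_dil hstar0 s01.
have star1 (s : R) p : 0 <= s <= 1 -> closure O1 p -> closure O1 (dil_at p0 s p).
  move=> s01; apply: closure_dil_at => q; exact: starshaped_at_dil hstar1 s01.
have O0_cases p : O0 p -> O p \/ closure O1 p.
  by move=> pO0; have [?|?] := pselect (closure O1 p); [right|left].
have bdO0 p : closure O0 p -> ~ O0 p -> boundary O0 p.
  by move=> cp nO0p; split => // /interior_subset.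
have f01 p : closure O0 p -> 0 <= f p <= 1.
  move=> cp; have [pO0|nO0p] := pselect (O0 p).
    have [/f_range//|/f_inner ->] := O0_cases p pO0; by rewrite ler01 lexx.
  by rewrite (f_outer p (bdO0 p cp nO0p)) lexx ler01.
(* The extension of f by 0 outside O0. *)
pose g p := if `[< O0 p >] then f p else 0.
have gO0 p : O0 p -> g p = f p by rewrite /g; case: asboolP.
have gN p : ~ O0 p -> g p = 0 by rewrite /g; case: asboolP.
have gcl p : closure O0 p -> g p = f p.
  move=> cp; have [/gO0//|nO0p] := pselect (O0 p).
  by rewrite gN// f_outer//; exact: bdO0.
have g01 p : 0 <= g p <= 1.
  have [pO0|nO0p] := pselect (O0 p); last by rewrite gN// lexx ler01.
  by rewrite gO0//; apply/f01/subset_closure.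
have g_cont : continuous g.
  have cover : closure O `|` (closure O1 `|` ~` O0) = setT.
    apply/seteqP; split => // p _; have [pO0|nO0p] := pselect (O0 p);
      last by right; right.
    have [pO|cp] := O0_cases p pO0; last by right; left.
    by left; exact: subset_closure.
  (* On each of these three closed sets g is f, 1 or 0. *)
  apply/continuous_subspace_setT; rewrite -cover.
  apply: withinU_continuous; [exact: closed_closure| | |].
  - by apply: closedU; [exact: closed_closure|exact: open_closedC].
  - apply: subspace_eq_continuous f_cont => p; rewrite inE => cp; apply/esym/gcl.
    by apply: closureS cp => q [].
  - apply: withinU_continuous; [exact: closed_closure|exact: open_closedC| |].
    + have c1 : {within closure O1, continuous (cst 1 : G -> R)}.
        exact/continuous_subspaceT/cst_continuous.
      apply: subspace_eq_continuous c1 => p.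
      by rewrite inE /from_subspace => cp; rewrite gO0 ?f_inner//; exact: cO10.
    + have c0 : {within ~` O0, continuous (cst 0 : G -> R)}.
        exact/continuous_subspaceT/cst_continuous.
      apply: subspace_eq_continuous c0 => p.
      by rewrite inE /from_subspace => nO0p; rewrite gN.
(* f does not decrease along contractions. *)
have mono (s : R) : 1 <= s -> forall p, O p -> g (dil_at p0 s p) <= f p.
  move=> s1.
  have s0 : 0 < s by exact: lt_le_trans ltr01 s1.
  have si : 0 <= s^-1 <= 1 by rewrite invr_ge0 ltW//= invf_le1.
  have sK p : dil_at p0 s^-1 (dil_at p0 s p) = p.
    by rewrite dil_at_comp mulVf ?gt_eqF// dil_at1.
  pose w := g \max (g \o dil_at p0 s).
  have wg p : g p <= w p by rewrite /w le_max lexx.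
  have wgs p : g (dil_at p0 s p) <= w p by rewrite /w le_max lexx orbT.
  have w_cont : continuous w.
    move=> p; apply: continuous_max; first exact: g_cont.
    by apply: continuous_comp; [exact: dil_at_continuous|exact: g_cont].
  (* The point p where phi touches w satisfies either w p = f p, or
     g (dil_at p0 s p) > 0, and then dil_at p0 s p lies in O. *)
  have w_sub : viscosity_subsolution e F O w.
    split; first exact: continuous_subspaceT.
    move=> p Op phi phi2 [phip phi_ge].
    have pO0 : O0 p by case: Op.
    have [le_gs|lt_gs] := leP (g (dil_at p0 s p)) (g p).
      have wp : w p = f p by rewrite /w/= max_l// gO0.
      rewrite wp; apply: (f_sol.1.2 p Op phi phi2); split; first by rewrite phip.
      have := nO p Op; apply: filterS2 phi_ge => q wphi [qO0 _].
      by rewrite -gO0//; exact: le_trans (wg q) wphi.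
    have wp : w p = g (dil_at p0 s p) by rewrite /w/= max_r// ltW.
    have O0sp : O0 (dil_at p0 s p).
      apply: contrapT => /gN gs0; move: lt_gs; rewrite gs0 ltNge.
      by case/andP: (g01 p) => ->.
    have Osp : O (dil_at p0 s p).
      split => // /(star1 _ _ si); rewrite sK; by case: Op.
    rewrite wp gO0//.
    apply: (dilated_subsolution k0 he1 oO scaling f_sol.1 s1 Op Osp phi2).
    split; first by rewrite phip wp /= gO0.
    have : nbhs p (dil_at p0 s @^-1` O0) by apply: dil_at_continuous; exact: nO0.
    apply: filterS2 phi_ge => q wphi O0sq.
    by rewrite /= -gO0//; exact: le_trans (wgs q) wphi.
  have w_bd p : boundary O p -> w p <= f p.
    move=> [clp nip]; have nOp : ~ O p by rewrite -(interior_id O).1.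
    have clO0p : closure O0 p by apply: closureS clp => q [].
    have [pO0|nO0p] := pselect (O0 p).
      have [//|c1p] := O0_cases p pO0.
      rewrite (f_inner p c1p) /w ge_max.
      by case/andP: (g01 p) => _ ->; case/andP: (g01 (dil_at p0 s p)) => _ ->.
    have nO0sp : ~ O0 (dil_at p0 s p).
      by move=> /(star0 _ _ si); rewrite sK.
    by rewrite /w/= !gN// maxxx (f_outer p (bdO0 p clO0p nO0p)).
  move=> p Op; apply: le_trans (wgs p) _.
  apply: (comparison w f) => //; last exact: subset_closure.
  - exact: continuous_subspaceT.
  - exact: f_sol.2.
have [l0 l1] := andP hl.
have clO10 p : closure O1 p -> closure O0 p by move=> /cO10; exact: subset_closure.
apply: starshaped_atP.
  have c1p0 : closure O1 p0 by exact: subset_closure.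
  by split; [exact: clO10|rewrite f_inner// ltW].
move=> s p s01 [clp lfp].
split; first by apply: closure_dil_at clp => q; exact: star0.
have [c1q|nc1q] := pselect (closure O1 (dil_at p0 s p)); first by rewrite f_inner// ltW.
have pO0 : O0 p.
  apply: contrapT => nO0p; move: lfp.
  by rewrite (f_outer p (bdO0 p clp nO0p)) leNgt l0.
have Oq : O (dil_at p0 s p) by split => //; exact: star0.
(* For s = 0 the dilate of p is p0, which belongs to O1. *)
have s0 : s != 0.
  apply/eqP => s0; apply: nc1q; rewrite s0 /dil_at dil0 mulg1.
  exact: subset_closure.
have s_gt0 : 0 < s by rewrite lt_def s0; case/andP: s01.
have s1 : 1 <= s^-1 by rewrite invf_ge1//; case/andP: s01.
have := mono s^-1 s1 _ Oq; rewrite dil_at_comp mulVf// dil_at1 gO0//.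
exact: le_trans.
Qed.
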